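(* Assume that $\alpha>3$ and that there exist constants $a\ge1$ and $\delta$ with $0<\delta<\alpha-3$ such that $$2\dot\varepsilon(t)\ \le\ -a\beta\varepsilon^2(t)\quad\text{for all } t\ge t_0,$$ $$\int_{t_0}^{+\infty}t\,\varepsilon(t)\,dt<+\infty,$$ $$b(t_0)\ge\frac{\beta}{t_0}\quad\text{and}\quad b(t_0)>\frac1a,$$ $$(\alpha-3)\,t\,b(t)-t^2\dot b(t)+\beta(2-\alpha)\ \ge\ \delta\,t\,b(t)\quad\text{for all } t\ge t_0.$$ Let $x:[t_0,+\infty)\to H$ be a solution of $$\ddot x(t)+\frac{\alpha}{t}\dot x(t)+\beta\frac{d}{dt}\nabla\Phi_{\lambda(t)}(x(t))+b(t)\nabla\Phi_{\lambda(t)}(x(t))+\varepsilon(t)x(t)=0,\qquad t\ge t_0.$$ Then the function $$t\mapsto t\left\langle\left(b(t)-\frac{\beta}{t}\right)\nabla\Phi_{\lambda(t)}(x(t)),\,x(t)-x^*\right\rangle$$ belongs to $L^1([t_0,+\infty),\mathbb{R})$. In addition, for every $q$ with $2\le q\le\alpha-1$, the function $$\psi(t)=\left(t^2b(t)-\beta(q+2-\alpha)t\right)\left(\Phi_{\lambda(t)}(x(t))-\Phi^*\right)+\frac{t^2\varepsilon(t)}{2}\|x(t)\|^2+\frac{t^2}{2}\|\dot x(t)+\beta\nabla\Phi_{\lambda(t)}(x(t))\|^2$$ satisfies $\lim_{t\to+\infty}\psi(t)=0$, which in particular means that, as $t\to+\infty$, $$\Phi_{\lambda(t)}(x(t))-\Phi^*=o\left(\frac{1}{t^2b(t)}\right),\qquad\|\dot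 x(t)+\beta\nabla\Phi_{\lambda(t)}(x(t))\|=o\left(\frac1t\right).$$ Moreover, as $t\to+\infty$, $$\Phi\left(\mathrm{prox}_{\lambda(t)\Phi}(x(t))\right)-\Phi^*=o\left(\frac{1}{t^2b(t)}\right),$$ $$\|\mathrm{prox}_{\lambda(t)\Phi}(x(t))-x(t)\|=o\left(\frac{\sqrt{\lambda(t)}}{t\sqrt{b(t)}}\right),$$ $$\|\nabla\Phi_{\lambda(t)}(x(t))\|=o\left(\frac{1}{t\sqrt{b(t)\lambda(t)}}\right).$$
   Context: $H$ is a real Hilbert space with inner product $\langle\cdot,\cdot\rangle$ and norm $\|\cdot\|$. $\Phi:H\to\mathbb{R}\cup\{\pm\infty\}$ is proper, convex and lower semicontinuous with nonempty set of global minimizers $\operatorname{argmin}\Phi$; $\Phi^*$ is its minimal value, and $x^*=\mathrm{proj}_{\operatorname{argmin}\Phi}(0)$ is the minimal norm element of $\operatorname{argmin}\Phi$. For $\lambda>0$ the Moreau envelope is $\Phi_\lambda(x)=\inf_{y\in H}\{\Phi(y)+\frac{1}{2\lambda}\|x-y\|^2\}$, a convex continuously differentiable function with $\nabla\Phi_\lambda$ being $\frac1\lambda$-Lipschitz, and the proximal operator is $\mathrm{prox}_{\lambda\Phi}(x)=\operatorname{argmin}_{y\in H}\{\Phi(y)+\frac{1}{2\lambda}\|x-y\|^2\}$. Standing assumptions: $\alpha,\beta,t_0>0$; $\lambda:[t_0,+\infty)\to(0,+\infty)$ and $b:[t_0,+\infty)\to[0,+\infty)$ are non-decreasing and differentiable;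 $\varepsilon:[t_0,+\infty)\to[0,+\infty)$ is continuously differentiable and non-increasing with $\lim_{t\to+\infty}\varepsilon(t)=0$. A solution is a strong global solution: $x$ is continuously differentiable with $\dot x$ locally absolutely continuous, satisfies the equation for almost every $t\ge t_0$, and has some initial data $x(t_0)=x_0\in H$, $\dot x(t_0)=\dot x_0\in H$. *)

(* Defs.v *)
From mathcomp Require Import all_boot all_order all_algebra.
From mathcomp Require Import sesquilinear.
From mathcomp Require Import all_classical all_reals all_analysis.

Set Implicit Arguments.
Unset Strict Implicit.
Unset Printing Implicit Defensive.

Import Order.TTheory GRing.Theory Num.Theory.
Import numFieldNormedType.Exports.

Local Open Scope classical_set_scope.
Local Open Scope ring_scope.

(* The Landau notations want the filter bundled with its proof. *)
Definition at_pinfty {R : realType} : filter_on R := FilterType (+oo_ R) _.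

Section Calculus.
Context {R : realType} {V : normedModType R}.

(* Functions on [t0, +oo) are represented by total functions on R whose values
   below t0 are irrelevant: every derivative is taken relative to D, hence is
   one-sided at an endpoint of D. *)
Definition derivable_within (D : set R) (f : R -> V) (t : R) : Prop :=
  cvg ((s - t)^-1 *: (f s - f t) @[s --> within D t^']).

Definition derive_within (D : set R) (f : R -> V) (t : R) : V :=
  lim ((s - t)^-1 *: (f s - f t) @[s --> within D t^']).

Definition cont_derivable_within (D : set R) (f : R -> V) : Prop :=
  (forall t, D t -> derivable_within D f t) /\
  {within D, continuous (derive_within D f)}.

(* The intervals [u i, v i] may be degenerate and share endpoints, but do not
   overlap. *)
Definition abs_continuous (a b : R) (f : R -> V) : Prop :=
  forall e : R, 0 < e -> exists2 d : R, 0 < d &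
    forall (n : nat) (u v : 'I_n -> R),
      (forall i, a <= u i /\ u i <= v i /\ v i <= b) ->
      (forall i j, i != j -> v i <= u j \/ v j <= u i) ->
      \sum_(i < n) (v i - u i) < d ->
      \sum_(i < n) `|f (v i) - f (u i)| < e.

End Calculus.

Section ExtendedFunctions.
Context {R : realType} {V : normedModType R}.
Implicit Types (Phi : V -> \bar R).

Definition proper_ereal Phi : Prop :=
  (forall x, -oo < Phi x)%E /\ (exists x, Phi x < +oo)%E.

Definition convex_ereal Phi : Prop :=
  forall (x y : V) (l : R), 0 < l -> l < 1 ->
    (Phi (l *: x + (1 - l) *: y)%R <= l%:E * Phi x + (1 - l)%:E * Phi y)%E.

Definition argmin Phi : set V := [set x | forall y, (Phi x <= Phi y)%E].

(* [fine] sends infinite values to 0; the infima below are finite as soon as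
   Phi is proper and argmin Phi is nonempty (and 0 < l). *)
Definition min_value Phi : R := fine (ereal_inf (range Phi)).

Definition prox_objective Phi (l : R) (x y : V) : \bar R :=
  (Phi y + ((2 * l)^-1 * `|x - y| ^+ 2)%:E)%E.

Definition moreau Phi (l : R) (x : V) : R :=
  fine (ereal_inf (range (prox_objective Phi l x))).

(* Here and below [get] picks an element of a set that is a singleton for proper
   convex lower semicontinuous functions on a Hilbert space (and 0 < l); it is
   arbitrary when the set is empty. *)
Definition prox Phi (l : R) (x : V) : V := get (argmin (prox_objective Phi l x)).

Definition metric_proj (A : set V) (z : V) : V :=
  get [set p | A p /\ forall a, A a -> `|z - p| <= `|z - a|].

End ExtendedFunctions.

Section Dynamics.
Context {R : realType} {H : normedModType R}.
Variable ip : H -> H -> R.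

Definition is_gradient (f : H -> R) (x g : H) : Prop :=
  differentiable f x /\ forall h, 'd f x h = ip g h.

Definition gradient (f : H -> R) (x : H) : H := get (is_gradient f x).

Definition grad_moreau (Phi : H -> \bar R) (l : R) (x : H) : H :=
  gradient (moreau Phi l) x.

(* At almost every t, the equation includes the existence of the two
   derivatives that occur in it besides x'. *)
Definition strong_solution (alpha beta t0 : R) (Phi : H -> \bar R)
    (lambda b eps : R -> R) (x0 v0 : H) (x : R -> H) : Prop :=
  let D : set R := `[t0, +oo[%classic in
  let dx := derive_within D x in
  let g := fun t => grad_moreau Phi (lambda t) (x t) in
  [/\ cont_derivable_within D x,
      forall T, t0 <= T -> abs_continuous t0 T dx,
      {ae lebesgue_measure, forall t, D t ->
        [/\ derivable_within D dx t, derivable_within D g t &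
          derive_within D dx t + (alpha / t) *: dx t
          + beta *: derive_within D g t + b t *: g t + eps t *: x t = 0]} &
      x t0 = x0 /\ dx t0 = v0].

End Dynamics.

(* Main.v *)
Require Import Defs.
From HB Require Import structures.
From mathcomp Require Import all_boot all_order all_algebra.
From mathcomp Require Import sesquilinear.
From mathcomp Require Import all_classical all_reals all_analysis.
From mathcomp Require Import measurable_realfun.
From mathcomp Require Import ring lra.
Set Implicit Arguments.
Unset Strict Implicit.
Unset Printing Implicit Defensive.
Import Order.TTheory GRing.Theory Num.Theory.
Import numFieldNormedType.Exports.
Local Open Scope classical_set_scope.
Local Open Scope ring_scope.

(** Let g(t) be the gradient of the envelope along the trajectory, w = x' + beta g,
    gap(t) the excess of the envelope over the minimal value of Phi, and z = xstar.
    For 2 <= q <= alpha - 1 the energy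
      E_q = psi_q + q t <x - z, w> + q (alpha - 1) / 2 |x - z|^2
    is a sum of non-negative terms (energyE). Along the trajectory the indefinite
    terms of its derivative cancel, and what is left (denergy_le) is dissipation,
    a multiple of the integrable weight t eps(t) and a multiple of t b gap.

    For q = alpha - 1 the growth condition on b makes the last multiple negative.
    Hence E_(alpha-1) converges, and t b gap as well as the pairing
    (t b - beta) <g, x - z> have bounded integrals: the latter is the claimed
    integrability. For q = 2 a large multiple of E_(alpha-1) absorbs the term in
    t b gap. Hence E_2 converges, x is bounded, and t |x'|^2 and t^2 |g|^2 have
    bounded integrals too. The difference of the two energies is a multiple of
    t <x - z, w> + (alpha - 1) / 2 |x - z|^2, up to a multiple of t gap, which tends
    to 0. So this sum converges, and psi_2 = E_2 - 2 (this sum) has a limit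
    (psi2_cvg). Since psi_2(t) / t is bounded by integrable quantities while 1/t is
    not integrable, the limit is 0 (psi2_cvg0), and psi_q differs from psi_2 by a
    multiple of t gap. The rates for gap and w are those of two terms of psi, and
    the three others follow from the identity (moreau_gapE)
      gap = (Phi (prox x) - min Phi) + |prox x - x|^2 / (2 lambda)
    in which |prox x - x| = lambda |g|.

    This computation needs the energies to be differentiable, but the equation
    holds almost everywhere and lambda is merely differentiable, so that absolute
    continuity of g is not immediate. Two facts replace it. First, w is differentiable
    at every t > t0 (velocity_is_derive): x' is absolutely continuous, and g is
    pointwise Lipschitz since the Yosida approximation is Lipschitz in the point and
    in the parameter (yosida_lipschitz); for sums of two such functions an almost
    everywhere bound on the derivative bounds the increments (mean_value_ae), and
    the derivative of w prescribed by the equation is continuous. Secondly, gap is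
    differentiable at every t > t0 (gap_is_derive), because the envelope is jointly
    convex in the point and the parameter and lies below the proximal objective at a
    fixed point. The energies are thus differentiable on ]t0, +oo[, and the
    classical mean value theorem suffices. *)

(** * Inner products *)

Section InnerProduct.
Context {R : realType} {H : normedModType R} (ip : {dot H for idfun}).
Implicit Types (u v w : H) (c : R).

Lemma ipC u v : ip u v = ip v u.
Proof. by rewrite hermC /= expr0 mul1r. Qed.

Lemma ipDl u v w : ip (u + v) w = ip u w + ip v w.
Proof. exact: linearDl. Qed.

Lemma ipDr u v w : ip w (u + v) = ip w u + ip w v.
Proof. exact: linearD. Qed.

Lemma ipNl u v : ip (- u) v = - ip u v.
Proof. exact: linearNl. Qed.

Lemma ipNr u v : ip v (- u) = - ip v u.
Proof. exact: linearN. Qed.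

Lemma ipZl c u v : ip (c *: u) v = c * ip u v.
Proof. by rewrite linearZl_LR. Qed.

Lemma ipZr c u v : ip v (c *: u) = c * ip v u.
Proof. by rewrite linearZr_LR. Qed.

Definition ipE := (ipDl, ipDr, ipNl, ipNr, ipZl, ipZr).

Hypothesis ip_norm : forall u : H, ip u u = `|u| ^+ 2.

Lemma normD_sqr u v : `|u + v| ^+ 2 = `|u| ^+ 2 + 2 * ip u v + `|v| ^+ 2.
Proof. by rewrite -!ip_norm !ipE (ipC v u); ring. Qed.

Lemma normB_sqr u v : `|u - v| ^+ 2 = `|u| ^+ 2 - 2 * ip u v + `|v| ^+ 2.
Proof. by rewrite -!ip_norm !ipE (ipC v u); ring. Qed.

Lemma normZ_sqr c u : `|c *: u| ^+ 2 = c ^+ 2 * `|u| ^+ 2.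
Proof. by rewrite -!ip_norm !ipE; ring. Qed.

Lemma norm_midpoint_sqr u v :
  `|2^-1 *: (u + v)| ^+ 2 =
  2^-1 * `|u| ^+ 2 + 2^-1 * `|v| ^+ 2 - 4^-1 * `|u - v| ^+ 2.
Proof. by rewrite normZ_sqr normD_sqr normB_sqr; field. Qed.

Lemma cauchy_schwarz u v : `|ip u v| <= `|u| * `|v|.
Proof.
have [->|v0] := eqVneq v 0; first by rewrite (linear0 (ip u)) !normr0 mulr0.
have nv0 : 0 < `|v| ^+ 2 by rewrite exprn_gt0 // normr_gt0.
have : 0 <= `|(`|v| ^+ 2) *: u - ip u v *: v| ^+ 2 by exact: sqr_ge0.
rewrite normB_sqr !normZ_sqr !ipE => h.
have : 0 <= `|v| ^+ 2 * ((`|u| * `|v|) ^+ 2 - ip u v ^+ 2).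
  by apply: le_trans h _; rewrite le_eqVlt; apply/orP; left; apply/eqP; ring.
rewrite pmulr_rge0 // subr_ge0 -[X in X <= _]real_normK ?num_real //.
by rewrite ler_pXn2r // nnegrE ?mulr_ge0.
Qed.

Lemma ip_le u v : ip u v <= `|u| * `|v|.
Proof. exact: le_trans (ler_norm _) (cauchy_schwarz u v). Qed.

Lemma cvg_ip (T : Type) (F : set_system T) {FF : Filter F} (f g : T -> H) u v :
  f @ F --> u -> g @ F --> v -> ip (f t) (g t) @[t --> F] --> ip u v.
Proof.
move=> fu gv.
have -> : (fun t => ip (f t) (g t)) =
    (fun t => ip (f t - u) (g t - v) + ip (f t - u) v + ip u (g t)).
  by apply/funext => t; rewrite !ipE; ring.
have fu0 : `|f t - u| @[t --> F] --> (0 : R).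
  by rewrite -(@normr0 _ H) -(subrr u); apply: cvg_norm; apply: cvgB => //; exact: cvg_cst.
have gv0 : `|g t - v| @[t --> F] --> (0 : R).
  by rewrite -(@normr0 _ H) -(subrr v); apply: cvg_norm; apply: cvgB => //; exact: cvg_cst.
have small (h1 h2 : T -> H) : `|h1 t| * `|h2 t| @[t --> F] --> (0 : R) ->
    ip (h1 t) (h2 t) @[t --> F] --> (0 : R).
  move=> h; apply/norm_cvg0P; apply: squeeze_cvgr h; last exact: cvg_cst.
  by apply: nearW => t /=; rewrite normr_ge0 cauchy_schwarz.
have -> : ip u v = 0 + 0 + ip u v by rewrite !add0r.
apply: cvgD; first apply: cvgD.
- by apply: small; rewrite -(mulr0 0); exact: cvgM.
- apply: (small (fun t => f t - u) (fun=> v)).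
  by rewrite -(mul0r `|v|); apply: cvgM => //; exact: cvg_cst.
- rewrite -[X in _ --> X](add0r (ip u v)).
  have -> : (fun t => ip u (g t)) = (fun t => ip u (g t - v) + ip u v).
    by apply/funext => t; rewrite !ipE; ring.
  apply: cvgD; last exact: cvg_cst.
  apply: (small (fun=> u) (fun t => g t - v)).
  by rewrite -(mulr0 `|u|); apply: cvgM => //; exact: cvg_cst.
Qed.

End InnerProduct.

(** * Minimizers of strongly convex functions *)

Section Minimizers.
Context {R : realType} {H : completeNormedModType R}.

Lemma ereal_inf_range_fin (J : H -> \bar R) (m : R) :
  (forall x, m%:E <= J x)%E -> (exists x, J x < +oo)%E ->
  ereal_inf (range J) \is a fin_num.
Proof.
move=> Jm [x Jx].
have inf_lt : (ereal_inf (range J) < +oo)%E.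
  by apply: le_lt_trans Jx; apply: ereal_inf_lbound; exists x.
have inf_gt : (m%:E <= ereal_inf (range J))%E.
  by apply: le_ereal_inf_tmp => _ [y _ <-].
by rewrite fin_numElt inf_lt (lt_le_trans _ inf_gt) ?ltNyr.
Qed.

(** The quadratic gain at midpoints makes every minimizing sequence Cauchy, and
    lower semicontinuity passes the infimum to its limit. *)
Lemma strongly_convex_minimizer (J : H -> \bar R) (m c : R) : 0 < c ->
  (forall x, m%:E <= J x)%E -> (exists x, J x < +oo)%E ->
  lower_semicontinuous J ->
  (forall x y, J (2^-1 *: (x + y))%R + (c * `|x - y| ^+ 2)%:E <=
     2^-1%:E * J x + 2^-1%:E * J y)%E ->
  argmin J !=set0.
Proof.
move=> c0 Jm Jfin Jlsc Jmid.
have finI := ereal_inf_range_fin Jm Jfin.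
set I := ereal_inf (range J) in finI *.
have Ilb y : (I <= J y)%E by apply: ereal_inf_lbound; exists y.
have [r rI] : exists r : R, I = r%:E by exists (fine I); rewrite fineK.
have eps_gt0 n : 0 < n.+1%:R^-1 :> R by rewrite invr_gt0.
have : forall n : nat, exists x, (J x < (r + n.+1%:R^-1)%:E)%E.
  move=> n; have : (I < (r + n.+1%:R^-1)%:E)%E by rewrite rI lte_fin ltrDl.
  by move=> /ereal_inf_lt [_ [x _ <-] Jx]; exists x.
move=> /choice [x Jx].
have xE n : exists2 s, J (x n) = s%:E & s < r + n.+1%:R^-1.
  have := Ilb (x n); have := Jx n; rewrite rI.
  case: (J (x n)) => [s||] //; rewrite lte_fin => h _; by exists s.
have x_close n k : (n <= k)%N -> c * `|x n - x k| ^+ 2 <= n.+1%:R^-1.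
  move=> nk; have [s Es ls] := xE n; have [s' Es' ls'] := xE k.
  have := Jmid (x n) (x k); rewrite Es Es' -!EFinM -EFinD.
  have := Ilb (2^-1 *: (x n + x k)); rewrite rI.
  case: (J _) => [q||] //; rewrite -EFinD !lee_fin => h1 h2.
  have : k.+1%:R^-1 <= n.+1%:R^-1 :> R by rewrite lef_pV2 ?posrE // ler_nat.
  move: (n.+1%:R^-1) (k.+1%:R^-1) (c * _) ls ls' h2 => A B C ls ls' h2 AB.
  by lra.
have cx : cvg (x @ \oo).
  apply/cauchy_cvgP/cauchy_exP => e e0; rewrite /fmapE.
  have ce0 : 0 < c * e ^+ 2 by rewrite mulr_gt0 // exprn_gt0.
  have [N _ NP] := near_infty_natSinv_lt (PosNum ce0).
  exists (x N); exists N => // k /= Nk.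
  rewrite -ball_normE /=.
  have := le_lt_trans (x_close _ _ Nk) (NP N (leqnn _)).
  by rewrite /= ltr_pM2l // ltr_pXn2r // nnegrE // ltW.
exists (lim (x @ \oo)) => y; apply: le_trans (Ilb y).
rewrite leNgt; apply/negP; rewrite rI => rJ.
have [a ra aJ] : exists2 a, r < a & (a%:E < J (lim (x @ \oo)))%E.
  move: rJ; case: (J _) => [s||] //; last by exists (r + 1); rewrite ?ltrDl ?ltry.
  by rewrite lte_fin => rs; exists ((r + s) / 2); rewrite ?lte_fin; lra.
have [V Vl aV] := Jlsc _ _ aJ.
have ar0 : 0 < a - r by rewrite subr_gt0.
have [N _ NP] := near_infty_natSinv_lt (PosNum ar0).
have [M _ MP] := cx V Vl.
have /aV := MP (maxn N M) (leq_maxr _ _).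
have [s -> ss] := xE (maxn N M); rewrite lte_fin.
have /= := NP (maxn N M) (leq_maxl _ _).
by move: (_.+1%:R^-1) ss => A ss; lra.
Qed.

End Minimizers.

(** * Projections and proximal points *)

Section Prox.
Context {R : realType} {H : completeNormedModType R} (ip : {dot H for idfun}).
Hypothesis ip_norm : forall u : H, ip u u = `|u| ^+ 2.
Context (Phi : H -> \bar R).
Hypothesis Phi_proper : proper_ereal Phi.
Hypothesis Phi_convex : convex_ereal Phi.
Hypothesis Phi_lsc : lower_semicontinuous Phi.
Hypothesis Phi_argmin : argmin Phi !=set0.

Lemma exists_real_between (r : R) (e : \bar R) : (r%:E < e)%E ->
  exists2 s : R, r < s & (s%:E < e)%E.
Proof.
case: e => [s||] //; last by exists (r + 1); rewrite ?ltrDl ?ltry.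
by rewrite lte_fin => rs; exists ((r + s) / 2); rewrite ?lte_fin; lra.
Qed.

(** Convexity inequalities at a point outside the domain reduce to this one. *)
Lemma half_addye (e : \bar R) : (-oo < e)%E ->
  (2^-1%:E * +oo + 2^-1%:E * e = +oo)%E.
Proof.
have h : (0 < (2^-1 : R)%:E)%E by rewrite lte_fin invr_gt0.
by rewrite gt0_muley //; case: e => [r||] // _; rewrite ?gt0_muley.
Qed.

Lemma lower_semicontinuousD_real (f : H -> \bar R) (g : H -> R) :
  lower_semicontinuous f -> continuous g ->
  lower_semicontinuous (fun y => f y + (g y)%:E)%E.
Proof.
move=> flsc gc x a; rewrite -lteBlDr // -EFinB => /exists_real_between [s as1 sf].
have [V Vx Vf] := flsc _ _ sf.
have gs : a - s < g x by rewrite ltrBlDr addrC -ltrBlDr.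
have gV : \forall y \near x, a - s < g y.
  exact: (cvgr_gt (g x) (gc x)).
exists (V `&` [set y | a - s < g y]); first exact: filterI.
move=> y [/Vf fy /= gy]; rewrite -lteBlDr // -EFinB; apply: le_lt_trans fy.
by rewrite lee_fin; lra.
Qed.

Lemma convex_midpoint (x y : H) :
  (Phi (2^-1 *: (x + y))%R <= 2^-1%:E * Phi x + 2^-1%:E * Phi y)%E.
Proof.
have h : 1 - 2^-1 = 2^-1 :> R by field.
have := @Phi_convex x y 2^-1; rewrite h -scalerDr; apply; lra.
Qed.

Lemma value_at_argmin z : argmin Phi z -> Phi z = (min_value Phi)%:E.
Proof.
move=> zmin; rewrite /min_value.
have [x0 x0fin] := Phi_proper.2.
have zfin : Phi z \is a fin_num.
  by rewrite fin_numElt Phi_proper.1 (le_lt_trans (zmin x0)).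
suff -> : ereal_inf (range Phi) = Phi z by rewrite fineK.
apply/le_anti/andP; split; first by apply: ereal_inf_lbound; exists z.
by apply: le_ereal_inf_tmp => _ [y _ <-].
Qed.

Lemma min_value_le y : ((min_value Phi)%:E <= Phi y)%E.
Proof. by have [z zmin] := Phi_argmin; rewrite -(value_at_argmin zmin). Qed.

Lemma argmin_le_min_value z : (Phi z <= (min_value Phi)%:E)%E -> argmin Phi z.
Proof. by move=> h y; apply: le_trans h (min_value_le y). Qed.

Lemma continuous_norm_sqr : continuous (fun y : H => `|y| ^+ 2).
Proof.
move=> y; apply: (@continuous_comp _ _ _ (fun y : H => `|y|) (fun r : R => r ^+ 2)).
  exact: norm_continuous.
exact: exprn_continuous.
Qed.

(** A projection of the origin is a minimizer of the squared norm extended by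
    +oo outside argmin Phi. The extension is lower semicontinuous because
    argmin Phi is a sublevel set of Phi, and the parallelogram identity makes it
    strongly convex. *)
Lemma metric_proj_argmin : argmin Phi (metric_proj (argmin Phi) 0).
Proof.
suff [p pP] : exists p, argmin Phi p /\
    forall a, argmin Phi a -> `|0 - p| <= `|0 - a|.
  by have [] := @getI _ [set q | argmin Phi q /\
    forall a, argmin Phi a -> `|0 - q| <= `|0 - a|] p pP.
pose J (y : H) : \bar R := if `[< argmin Phi y >] then (`|y| ^+ 2)%:E else +oo%E.
have J_in y : argmin Phi y -> J y = (`|y| ^+ 2)%:E.
  by move=> h; rewrite /J asboolT.
have J_out y : ~ argmin Phi y -> J y = +oo%E.
  by move=> h; rewrite /J asboolF.
have J_gtNy y : (-oo < J y)%E by rewrite /J; case: ifP => _; rewrite ?ltNyr ?ltNyy.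
have [z zmin] := Phi_argmin.
have [|||||p pJ] := @strongly_convex_minimizer _ _ J 0 4^-1.
- by rewrite invr_gt0.
- move=> y; have [h|h] := pselect (argmin Phi y); last by rewrite J_out ?leey.
  by rewrite J_in // lee_fin sqr_ge0.
- by exists z; rewrite J_in // ltry.
- move=> y a; have [h|h] := pselect (argmin Phi y).
    rewrite J_in // lte_fin => ay.
    have ca : \forall t \near y, a < `|t| ^+ 2.
      exact: (cvgr_gt _ (@continuous_norm_sqr y)).
    exists [set t | a < `|t| ^+ 2] => // t /= at_.
    have [ht|ht] := pselect (argmin Phi t); last by rewrite J_out // ltry.
    by rewrite J_in // lte_fin.
  have : ((min_value Phi)%:E < Phi y)%E.
    by rewrite ltNge; apply/negP => /argmin_le_min_value.
  move=> /Phi_lsc [V Vy VPhi] _; exists V => // t /VPhi ht.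
  rewrite J_out ?ltry // => /value_at_argmin e.
  by rewrite e ltxx in ht.
- move=> x y.
  have [hx|hx] := pselect (argmin Phi x); last first.
    by rewrite (J_out x) // half_addye ?leey // J_gtNy.
  have [hy|hy] := pselect (argmin Phi y); last first.
    by rewrite (J_out y) // [in leRHS]addeC half_addye ?leey // J_gtNy.
  have hxy : argmin Phi (2^-1 *: (x + y)).
    apply: argmin_le_min_value; apply: le_trans (convex_midpoint x y) _.
    by rewrite (value_at_argmin hx) (value_at_argmin hy) -!EFinM -EFinD lee_fin; lra.
  rewrite !J_in // -!EFinM -!EFinD lee_fin (norm_midpoint_sqr ip_norm).
  by rewrite subrK.
exists p; have hp : argmin Phi p.
  have [//|h] := pselect (argmin Phi p).
  by have := pJ z; rewrite J_out // J_in // leye_eq.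
split=> // a ha; rewrite !sub0r !normrN.
by have := pJ a; rewrite !J_in // lee_fin ler_pXn2r // nnegrE.
Qed.

(** Strong convexity comes from the quadratic penalty alone. *)
Lemma prox_argmin (l : R) (x : H) : 0 < l ->
  argmin (prox_objective Phi l x) (prox Phi l x).
Proof.
move=> l0; rewrite /prox.
suff [p pP] : argmin (prox_objective Phi l x) !=set0 by exact: getI pP.
have l20 : 0 < (2 * l)^-1 by rewrite invr_gt0 mulr_gt0.
apply: (@strongly_convex_minimizer _ _ _ (min_value Phi) ((2 * l)^-1 / 4)).
- by rewrite divr_gt0.
- move=> y; apply: le_trans (min_value_le y) _.
  by rewrite leeDl // lee_fin mulr_ge0 ?sqr_ge0 // ltW.
- have [z zmin] := Phi_argmin; exists z.
  by rewrite /prox_objective (value_at_argmin zmin) -EFinD ltry.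
- apply: lower_semicontinuousD_real => // y.
  apply: cvgM; first exact: cvg_cst.
  apply: (@cvg_comp _ _ _ (fun z => x - z) (fun u : H => `|u| ^+ 2)).
    by apply: cvgB; [exact: cvg_cst | exact: cvg_id].
  exact: continuous_norm_sqr.
- move=> y z; rewrite /prox_objective.
  have e : x - 2^-1 *: (y + z) = 2^-1 *: ((x - y) + (x - z)).
    rewrite addrACA -opprD scalerBr; congr (_ - _).
    by rewrite -[in RHS](scale1r x) -scalerDl scalerA -[LHS]scale1r; congr (_ *: _); field.
  rewrite e (norm_midpoint_sqr ip_norm).
  have -> : x - y - (x - z) = - (y - z) by rewrite !opprB addrCA addrAC subrr add0r.
  rewrite normrN.
  have := convex_midpoint y z.
  have := Phi_proper.1 (2^-1 *: (y + z)).
  have := Phi_proper.1 y; have := Phi_proper.1 z.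
  case: (Phi y) => [r||] //; last first.
    move=> hz _ _ _; rewrite addye // half_addye ?leey //.
    by case: (Phi z) hz => [s||] // _; rewrite -?EFinD ?ltNyr.
  case: (Phi z) => [s||] // _ _; last first.
    by move=> _ _; rewrite addye // [in leRHS]addeC half_addye ?leey // -?EFinD ?ltNyr.
  case: (Phi _) => [q||] //; rewrite -!EFinM -!EFinD ?lee_fin // => h.
  set A := `|x - y| ^+ 2; set B := `|x - z| ^+ 2; set C := `|y - z| ^+ 2.
  set k := (2 * l)^-1; lra.
Qed.
End Prox.

(** * Moreau envelopes *)

Section MoreauEnvelope.
Context {R : realType} {H : completeNormedModType R} (ip : {dot H for idfun}).
Hypothesis ip_norm : forall u : H, ip u u = `|u| ^+ 2.
Context (Phi : H -> \bar R).
Hypothesis Phi_proper : proper_ereal Phi.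
Hypothesis Phi_convex : convex_ereal Phi.
Hypothesis Phi_lsc : lower_semicontinuous Phi.
Hypothesis Phi_argmin : argmin Phi !=set0.

Implicit Types (l m : R) (x y z : H).
Local Notation Phir := (fun y => fine (Phi y)).

(** The Yosida approximation of the subdifferential of Phi, which is the
    gradient of the envelope by grad_moreauE below. *)
Definition yosida (l : R) (x : H) : H := l^-1 *: (x - prox Phi l x).

Lemma sub_proxE l x : l != 0 -> x - prox Phi l x = l *: yosida l x.
Proof. by move=> l0; rewrite /yosida scalerA divff // scale1r. Qed.

Lemma proxE l x : l != 0 -> prox Phi l x = x - l *: yosida l x.
Proof. by move=> l0; rewrite -sub_proxE // opprB addrC subrK. Qed.

Lemma prox_fin_num l x : 0 < l -> Phi (prox Phi l x) \is a fin_num.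
Proof.
move=> l0; have [z zmin] := Phi_argmin.
have := prox_argmin ip_norm Phi_proper Phi_convex Phi_lsc Phi_argmin x l0.
move=> /(_ z); rewrite /prox_objective (value_at_argmin Phi_proper zmin) -EFinD.
have := Phi_proper.1 (prox Phi l x).
by case: (Phi _).
Qed.

Lemma argmin_fin_num z : argmin Phi z -> Phi z \is a fin_num.
Proof. by move=> zmin; rewrite (value_at_argmin Phi_proper zmin). Qed.

Lemma moreauE l x : 0 < l ->
  moreau Phi l x = Phir (prox Phi l x) + (2 * l)^-1 * `|x - prox Phi l x| ^+ 2.
Proof.
move=> l0; rewrite /moreau.
have pmin := prox_argmin ip_norm Phi_proper Phi_convex Phi_lsc Phi_argmin x l0.
suff -> : ereal_inf (range (prox_objective Phi l x)) =
    prox_objective Phi l x (prox Phi l x).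
  by rewrite /prox_objective -(fineK (prox_fin_num x l0)).
apply/le_anti/andP; split.
  by apply: ereal_inf_lbound; exists (prox Phi l x).
by apply: le_ereal_inf_tmp => _ [y _ <-].
Qed.

Lemma moreau_le l x y : 0 < l -> Phi y \is a fin_num ->
  moreau Phi l x <= Phir y + (2 * l)^-1 * `|x - y| ^+ 2.
Proof.
move=> l0 yfin; rewrite moreauE // -lee_fin !EFinD !fineK ?prox_fin_num //.
exact: (prox_argmin ip_norm Phi_proper Phi_convex Phi_lsc Phi_argmin x l0 y).
Qed.

(** Minimality of the proximal point p is tested at s y + (1 - s) p: the
    penalty varies by a term linear in s, which is the pairing, up to O(s^2). *)
Lemma prox_subgradient l x y : 0 < l -> Phi y \is a fin_num ->
  Phir (prox Phi l x) + ip (yosida l x) (y - prox Phi l x) <= Phir y.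
Proof.
move=> l0 yfin; set p := prox Phi l x.
have pfin : Phi p \is a fin_num := prox_fin_num x l0.
have k0 : 0 < (2 * l)^-1 by rewrite invr_gt0 mulr_gt0.
have key (s : R) : 0 < s -> s < 1 -> Phir p + ip (yosida l x) (y - p) <=
    Phir y + s * ((2 * l)^-1 * `|y - p| ^+ 2).
  move=> s0 s1.
  have cvx := Phi_convex y p s0 s1.
  set z := s *: y + (1 - s) *: p in cvx.
  have zfin : Phi z \is a fin_num.
    rewrite fin_numElt Phi_proper.1 /=; apply: le_lt_trans cvx _.
    by rewrite -(fineK yfin) -(fineK pfin) -!EFinM -EFinD ltry.
  have {}cvx : Phir z <= s * Phir y + (1 - s) * Phir p.
    by rewrite -lee_fin EFinD !EFinM !fineK.
  move: cvx; have := moreau_le x l0 zfin; rewrite moreauE // -/p.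
  have -> : x - z = (x - p) - s *: (y - p).
    rewrite /z scalerBl scale1r scalerBr !opprD !opprK !addrA.
    by rewrite [x - s *: y - p]addrAC addrAC.
  rewrite (normB_sqr ip_norm (x - p)) ipZr sub_proxE ?gt_eqF // ipZl.
  rewrite (normZ_sqr ip_norm s) (normZ_sqr ip_norm l).
  set Y := Phir y; set P := Phir p; set Z := Phir z.
  move: (ip _ _) (`|y - p| ^+ 2) (`|yosida l x| ^+ 2) => I N M.
  move: (Y) (P) (Z) => {Y P Z} /= Y P Z h cvx.
  have l2 : (2 * l)^-1 = 2^-1 * l^-1 by rewrite invfM.
  have ll : l^-1 * l = 1 by rewrite mulVf // gt_eqF.
  have h2 : s * (P + I) <= s * (Y + s * ((2 * l)^-1 * N)).
    have e1 : (2 * l)^-1 * (2 * (s * (l * I))) = s * I.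
      rewrite l2; transitivity ((l^-1 * l) * (s * I)); last by rewrite ll mul1r.
      by field; rewrite gt_eqF.
    move: h; rewrite !mulrDr mulrN e1 => h.
    have -> : s * (s * ((2 * l)^-1 * N)) = (2 * l)^-1 * (s ^+ 2 * N) by ring.
    by lra.
  by rewrite ler_pM2l in h2.
apply/ler_addgt0Pr => e e0.
set N := (2 * l)^-1 * `|y - p| ^+ 2 in key *.
have N0 : 0 <= N by rewrite mulr_ge0 ?sqr_ge0 // ltW.
pose s := Num.min (2^-1) (e / (N + 1)).
have s0 : 0 < s by rewrite lt_min invr_gt0 ltr0n /= divr_gt0 // ltr_wpDl.
have s1 : s < 1 by rewrite gt_min; apply/orP; left; lra.
apply: le_trans (key s s0 s1) _; rewrite lerD2l.
have : s <= e / (N + 1) by rewrite ge_min lexx orbT.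
rewrite ler_pdivlMr ?ltr_wpDl // mulrDr mulr1 => h.
by apply: le_trans h; rewrite lerDl ltW.
Qed.

(** The lower bound is affine in the pair (y, m), because the envelope is jointly
    convex in the point and the parameter. One inequality thus controls their
    simultaneous variation along a trajectory. It is the subgradient inequality at
    the proximal point of x, tested at that of y, up to the square
    m / 2 |yosida m y - yosida l x|^2. *)
Lemma moreau_ge_tangent l m x y : 0 < l -> 0 < m ->
  moreau Phi l x + ip (yosida l x) (y - x) - (m - l) / 2 * `|yosida l x| ^+ 2
  <= moreau Phi m y.
Proof.
move=> l0 m0; rewrite (moreauE y m0) moreauE //.
have := prox_subgradient x l0 (prox_fin_num y m0).
rewrite !sub_proxE ?gt_eqF //; rewrite (proxE x) ?(proxE y) ?gt_eqF //.
move: (fine (Phi (x - _))) (fine (Phi (y - _))) => P Q.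
move: (yosida l x) (yosida m y) => G K.
rewrite (normZ_sqr ip_norm l) (normZ_sqr ip_norm m) => h.
have : 0 <= m / 2 * `|K - G| ^+ 2 by rewrite mulr_ge0 ?sqr_ge0 // divr_ge0 // ltW.
have -> : (2 * m)^-1 * (m ^+ 2 * `|K| ^+ 2) = m / 2 * `|K| ^+ 2 by field; rewrite gt_eqF.
have -> : (2 * l)^-1 * (l ^+ 2 * `|G| ^+ 2) = l / 2 * `|G| ^+ 2 by field; rewrite gt_eqF.
rewrite (normB_sqr ip_norm) (ipC ip K G) => h2.
move: h; rewrite !ipE ip_norm => h.
move: (`|K| ^+ 2) (`|G| ^+ 2) (ip G K) (ip G x) (ip G y) h h2 => k g i gx gy h h2.
have e1 : m / 2 * (k - 2 * i + g) = m / 2 * k - m * i + m / 2 * g by field.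
have e2 : (m - l) / 2 * g = m / 2 * g - l / 2 * g by field.
rewrite e1 in h2; rewrite e2.
by move: (m * i) (m / 2 * k) (m / 2 * g) h h2 => A B C h h2; lra.
Qed.

Lemma moreau_le_min_value l z : 0 < l -> argmin Phi z ->
  moreau Phi l z <= min_value Phi.
Proof.
move=> l0 zmin; apply: le_trans (moreau_le z l0 (argmin_fin_num zmin)) _.
by rewrite subrr normr0 expr0n /= mulr0 addr0 (value_at_argmin Phi_proper zmin).
Qed.

Lemma moreau_gap_le l x z : 0 < l -> argmin Phi z ->
  moreau Phi l x - min_value Phi <= ip (yosida l x) (x - z).
Proof.
move=> l0 zmin; have := moreau_ge_tangent x z l0 l0.
have := moreau_le_min_value l0 zmin.
by rewrite subrr !mul0r subr0 -(opprB x z) ipNr; lra.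
Qed.

Lemma moreau_gapE l x : 0 < l -> moreau Phi l x - min_value Phi =
  (Phir (prox Phi l x) - min_value Phi) + l / 2 * `|yosida l x| ^+ 2.
Proof.
move=> l0; rewrite moreauE // sub_proxE ?gt_eqF // (normZ_sqr ip_norm l).
by rewrite addrAC; congr (_ + _); field; rewrite gt_eqF.
Qed.

Lemma prox_gap_ge0 l x : 0 < l -> 0 <= Phir (prox Phi l x) - min_value Phi.
Proof.
move=> l0; rewrite subr_ge0 -lee_fin (fineK (prox_fin_num x l0)).
exact: min_value_le.
Qed.

Lemma moreau_gap_ge0 l x : 0 < l -> 0 <= moreau Phi l x - min_value Phi.
Proof.
move=> l0; rewrite moreau_gapE // addr_ge0 ?prox_gap_ge0 //.
by rewrite mulr_ge0 ?sqr_ge0 // divr_ge0 // ltW.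
Qed.

(** Monotonicity of the subdifferential at the two proximal points, followed by
    the Cauchy-Schwarz inequality. *)
Lemma yosida_lipschitz l m x y : 0 < l -> 0 < m ->
  m * `|yosida m y - yosida l x| <= `|y - x| + `|m - l| * `|yosida l x|.
Proof.
move=> l0 m0.
have := prox_subgradient x l0 (prox_fin_num y m0).
have := prox_subgradient y m0 (prox_fin_num x l0).
rewrite (proxE x) ?(proxE y) ?gt_eqF //.
move: (fine (Phi (x - _))) (fine (Phi (y - _))) => P Q.
move: (yosida l x) (yosida m y) => G K.
move=> h1 h2.
have h : m * `|K - G| ^+ 2 <= ip (K - G) ((y - x) - (m - l) *: G).
  rewrite -ip_norm; rewrite !ipE in h1 h2 *; rewrite (ipC ip K G) in h1 h2 *.
  by lra.
have [->|KG] := eqVneq (K - G) 0; first by rewrite normr0 mulr0 addr_ge0 // mulr_ge0.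
have : `|K - G| * (m * `|K - G|) <= `|K - G| * (`|y - x| + `|m - l| * `|G|).
  rewrite mulrCA -expr2; apply: le_trans h _; apply: le_trans (ip_le ip_norm _ _) _.
  by rewrite ler_wpM2l // (le_trans (ler_normB _ _)) // normrZ.
by rewrite ler_pM2l // normr_gt0.
Qed.

(** The proximal point of x is a competitor in the definition of the envelope
    at y. *)
Lemma moreau_le_quadratic l x y : 0 < l -> moreau Phi l y <=
  moreau Phi l x + ip (yosida l x) (y - x) + (2 * l)^-1 * `|y - x| ^+ 2.
Proof.
move=> l0; apply: le_trans (moreau_le y l0 (prox_fin_num x l0)) _.
rewrite moreauE // -!addrA lerD2l sub_proxE ?gt_eqF //.
rewrite proxE ?gt_eqF //.
have -> : y - (x - l *: yosida l x) = (y - x) + l *: yosida l x by rewrite opprB addrCA addrC.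
rewrite (normD_sqr ip_norm) ipZr (ipC ip (y - x)) mulrDr mulrDr.
move: (_ * `|y - x| ^+ 2) (_ * `|_ *: _| ^+ 2) (ip _ _) => A B C.
by rewrite le_eqVlt; apply/orP; left; apply/eqP; field; rewrite gt_eqF.
Qed.

(** The affine minorant and the quadratic majorant differ by O(|y - x|^2), so the
    envelope is Frechet differentiable; definiteness of the inner product makes
    the vector representing the differential unique. *)
Lemma grad_moreauE l x : 0 < l -> grad_moreau ip Phi l x = yosida l x.
Proof.
move=> l0; set G := yosida l x.
have lin : linear (ip G : H -> R) by move=> c u v; rewrite ipDr ipZr.
pose linM := GRing.isLinear.Build _ _ _ _ _ lin.
pose dG : {linear H -> R} := HB.pack (ip G : H -> R) linM.
have dGc : continuous dG.
  by move=> u; apply: (@cvg_ip _ _ _ ip_norm); [exact: cvg_cst | exact: cvg_id].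
have approx : moreau Phi l \o shift x = cst (moreau Phi l x) + dG +o_ 0 id.
  apply/eqaddoP => e e0.
  near=> h; rewrite /= -[(_ - _) h]/(moreau Phi l (h + x) - (moreau Phi l x + ip G h)).
  have := moreau_ge_tangent x (h + x) l0 l0.
  have := moreau_le_quadratic x (h + x) l0.
  rewrite subrr !mul0r subr0 addrK -/G => h1 h2.
  rewrite ger0_norm ?subr_ge0 // lerBlDl; apply: le_trans h1 _; rewrite lerD2l.
  rewrite expr2 mulrA ler_wpM2r // mulrC ler_pdivrMr ?mulr_gt0 //.
  near: h; apply: nbhs0_le; by rewrite !mulr_gt0.
have dE : 'd (moreau Phi l) x = dG :> (H -> R) by exact: diff_unique.
have gP : is_gradient ip (moreau Phi l) x G.
  split; last by move=> h; rewrite dE.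
  by apply/diff_locallyP; rewrite dE.
have := getI gP; rewrite -/(gradient ip (moreau Phi l) x).
rewrite -/(grad_moreau ip Phi l x); move: (grad_moreau _ _ _ _) => K [_ dK].
have : ip (K - G) (K - G) = 0.
  by rewrite ipDl ipNl -dK dE subrr.
by rewrite ip_norm => /eqP; rewrite expf_eq0 /= normr_eq0 subr_eq0 => /eqP.
Unshelve. all: by end_near. Qed.

End MoreauEnvelope.

(** * A mean value inequality with a null exceptional set *)

Section NullMajorized.
Context {R : realType} {V : normedModType R}.
Implicit Types (a b t s e : R) (f g : R -> V) (N U : set R).
Local Notation mu := (@lebesgue_measure R).

(** On every null set N, the increments of f to the right are dominated by those
    of a nondecreasing function of arbitrarily small total increase: f gains
    nothing on null sets. Absolutely continuous functions and pointwise Lipschitz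
    ones share this property, and, unlike each of these two classes, it covers
    their sums. *)
Definition null_majorized a b f : Prop :=
  forall N, mu.-negligible N -> forall e, 0 < e ->
  exists M : R -> R,
    [/\ forall s t, a <= s -> s <= t -> t <= b -> M s <= M t,
        M b - M a <= e &
        forall t, N t -> a <= t -> t < b ->
          \forall s \near t^'+, `|f s - f t| <= M s - M t].

Lemma negligible_open_cover N e : mu.-negligible N -> 0 < e ->
  exists U, [/\ open U, N `<=` U & (mu U <= e%:E)%E].
Proof.
move=> /negligible_outer_measure N0 e0.
have [U [oU NU mU]] := outer_measure_open_le N e0.
by exists U; rewrite N0 add0e in mU.
Qed.

Lemma open_itv_right U t : open U -> U t ->
  \forall s \near t^'+, `[t, s]%classic `<=` U.
Proof.
move=> oU Ut; have /nbhs_ballP [r r0 rU] := open_nbhs_nbhs (conj oU Ut).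
have tr : t < t + r by rewrite ltrDl.
near=> s => z /=; rewrite in_itv /= => /andP[tz zs]; apply: rU.
rewrite /ball /= ler0_norm ?subr_le0 // opprB.
rewrite ltrBlDl; apply: le_lt_trans zs _.
by near: s; exact: nbhs_right_lt.
Unshelve. all: by end_near. Qed.

Lemma measure_itvNyc_add U t s : open U -> t <= s ->
  `[t, s]%classic `<=` U ->
  (mu (U `&` `]-oo, t]) + (s - t)%:E <= mu (U `&` `]-oo, s]))%E.
Proof.
move=> oU ts tsU; have mU : measurable U by exact: open_measurable.
have -> : (s - t)%:E = mu `]t, s].
  rewrite lebesgue_measure_itv /= lte_fin -EFinB.
  case: ifP => // /negbT; rewrite -leNgt => st.
  by rewrite (le_anti (introT andP (conj ts st))) subrr.
rewrite -measureU //; first last.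
- apply/seteqP; split => // z [[_] /=]; rewrite !in_itv /= => zt /andP[tz _].
  by have := lt_le_trans tz zt; rewrite ltxx.
- exact: measurableI.
apply: le_measure; rewrite ?inE.
- by apply: measurableU => //; exact: measurableI.
- exact: measurableI.
move=> z [[Uz]|] /=; rewrite !in_itv /=.
  by move=> zt; split=> //; rewrite (le_trans zt).
move=> /andP[tz zs]; split=> //.
by apply: tsU; rewrite /= in_itv /= ltW.
Qed.

(** The Lipschitz constant depends on t and need not be bounded. The open cover
    U k of N serves the points with constant at most k + 1, and it is taken so
    small that the weight k + 1 costs at most e / 2^(k+1). *)
Lemma pointwise_lipschitz_null_majorized a b f : a <= b ->
  (forall t, a <= t -> t < b -> exists C,
     \forall s \near t^'+, `|f s - f t| <= C * (s - t)) ->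
  null_majorized a b f.
Proof.
move=> ab flip N N0 e e0.
have dk k : 0 < e / (2 ^ k.+1)%:R / k.+1%:R by rewrite !divr_gt0 // ltr0n expn_gt0.
have [U UP] := choice (fun k => negligible_open_cover N0 (dk k)).
have oU k : open (U k) by have [] := UP k.
have NU k : N `<=` U k by have [] := UP k.
have mUt k t : measurable (U k `&` `]-oo, t]).
  by apply: measurableI => //; exact: open_measurable.
pose w t k := (k.+1%:R%:E * mu (U k `&` `]-oo, t]))%E.
have w0 t k : (0 <= w t k)%E by rewrite mule_ge0 // lee_fin.
have w_mono k s t : s <= t -> (w s k <= w t k)%E.
  move=> st; rewrite lee_pmul2l // ?lte_fin //.
  apply: le_measure; rewrite ?inE; [exact: mUt | exact: mUt | ].
  move=> z [Uz] /=; rewrite !in_itv /= => zs.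
  by split=> //; rewrite (le_trans zs).
pose m t := (\sum_(0 <= k <oo) w t k)%E.
have m0 t : (0 <= m t)%E by apply: nneseries_ge0.
have me t : (m t <= e%:E)%E.
  apply: (@le_trans _ _ (\sum_(0 <= k <oo) (e / (2 ^ k.+1)%:R)%:E)%E); last first.
    by apply: epsilon_trick0; exact: ltW.
  apply: lee_nneseries => // k _.
  have kpos : 0 < k.+1%:R :> R by rewrite ltr0n.
  have -> : (e / (2 ^ k.+1)%:R)%:E = (k.+1%:R%:E * (e / (2 ^ k.+1)%:R / k.+1%:R)%:E)%E.
    by rewrite -EFinM; congr (_%:E); field; rewrite ?gt_eqF // ltr0n expn_gt0.
  rewrite lee_pmul2l // ?lte_fin //.
  have [_ _] := UP k; apply: le_trans; apply: le_measure; rewrite ?inE.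
  - exact: mUt.
  - exact: open_measurable.
  - by move=> z [].
have mfin t : m t \is a fin_num.
  by rewrite ge0_fin_numE // (le_lt_trans (me t)) // ltry.
exists (fun t => fine (m t)); split.
- move=> s t _ st _; rewrite fine_le //.
  by apply: lee_nneseries => // k _; exact: w_mono.
- rewrite lerBlDr -lee_fin fineK // EFinD fineK //.
  by apply: le_trans (me b) _; rewrite leeDl.
- move=> t Nt at_ tb; have [C Clip] := flip t at_ tb.
  pose k := Num.truncn `|C|.
  have Ck : C <= k.+1%:R.
    by apply: le_trans (ler_norm _) _; exact/ltW/truncnS_gt.
  near=> s; have ts : t <= s by near: s; exact: nbhs_right_ge.
  have tsU : `[t, s]%classic `<=` U k.
    by near: s; apply: open_itv_right => //; exact: NU.
  apply: (@le_trans _ _ (k.+1%:R * (s - t))).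
    apply: (@le_trans _ _ (C * (s - t))); first by near: s.
    by rewrite ler_wpM2r // subr_ge0.
  rewrite lerBrDl -lee_fin EFinD !fineK //.
  rewrite /m (@nneseriesD1 _ _ k) // [leRHS](@nneseriesD1 _ _ k) //.
  rewrite addeAC; apply: leeD.
    rewrite /w EFinM -ge0_muleDr ?lee_fin ?subr_ge0 //.
    rewrite lee_pmul2l // ?lte_fin //.
    exact: measure_itvNyc_add.
  by apply: lee_nneseries => // j _; exact: w_mono.
Unshelve. all: by end_near. Qed.

(** Non-overlapping subintervals of [a, t] contained in U, listed from right to
    left so that a new rightmost interval is added by a cons. *)
Fixpoint interval_chain U a t (l : seq (R * R)) : Prop :=
  if l is p :: l' then
    [/\ a <= p.1, p.1 <= p.2, p.2 <= t, `[p.1, p.2]%classic `<=` U &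
        interval_chain U a p.1 l']
  else True.

Lemma interval_chain_widen U a t s l : t <= s ->
  interval_chain U a t l -> interval_chain U a s l.
Proof.
by case: l => //= p l ts [? ? pt ? ?]; split=> //; exact: le_trans pt ts.
Qed.

Lemma interval_chain_length U a t l : open U -> interval_chain U a t l ->
  ((\sum_(p <- l) (p.2 - p.1))%:E <= mu (U `&` `]-oo, t]))%E.
Proof.
move=> oU; elim: l t => [|[u v] l IH] t /=; first by rewrite big_nil.
move=> [au uv vt uvU /IH lU]; rewrite big_cons /= EFinD addeC.
apply: le_trans (leeD2r _ lU) _.
apply: le_trans (measure_itvNyc_add oU uv uvU) _.
apply: le_measure; rewrite ?inE.
- by apply: measurableI => //; exact: open_measurable.
- by apply: measurableI => //; exact: open_measurable.
move=> z [Uz] /=; rewrite !in_itv /= => zv.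
by split=> //; rewrite (le_trans zv).
Qed.

Lemma interval_chain_bounds U a t l p : interval_chain U a t l -> p \in l ->
  [/\ a <= p.1, p.1 <= p.2 & p.2 <= t].
Proof.
elim: l t => [|q l IH] t //= [aq qq qt qU ch]; rewrite inE => /predU1P [->|] //.
by move=> /(IH _ ch) [h1 h2 h3]; split=> //; rewrite (le_trans h3) // (le_trans qq).
Qed.

Lemma interval_chain_nth U a t l (i j : nat) : interval_chain U a t l ->
  (i < j)%N -> (j < size l)%N -> (nth (a, a) l j).2 <= (nth (a, a) l i).1.
Proof.
elim: l t i j => [|q l IH] t i [|j] //= [aq qq qt qU ch]; case: i => [|i] /= ij jl.
  by have [] := interval_chain_bounds ch (mem_nth (a, a) jl).
exact: IH ch _ _.
Qed.

(** The majorant at t is the variation of f over the part of U on the left of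
    t, for an open U around N so small that absolute continuity bounds it. *)
Lemma abs_continuous_null_majorized a b f : a <= b ->
  abs_continuous a b f -> null_majorized a b f.
Proof.
move=> ab ac N N0 e e0; have [d d0 dP] := ac e e0.
have d20 : 0 < d / 2 by rewrite divr_gt0.
have [U [oU NU mU]] := negligible_open_cover N0 d20.
pose var (l : seq (R * R)) := \sum_(p <- l) `|f p.2 - f p.1|.
have var_le l t : t <= b -> interval_chain U a t l -> var l <= e.
  move=> tb ch; rewrite /var (big_nth (a, a)) big_mkord.
  have bnd (i : 'I_(size l)) := interval_chain_bounds ch (mem_nth (a, a) (ltn_ord i)).
  apply: ltW; apply: dP => [i|i j ij|].
  - by have [? ? ?] := bnd i; split=> //; split=> //; exact: le_trans tb.
  - have [ilj|jli|ije] := ltngtP i j.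
    + by right; exact: interval_chain_nth ch _ _.
    + by left; exact: interval_chain_nth ch _ _.
    + by rewrite (val_inj ije) eqxx in ij.
  - have := interval_chain_length oU ch; rewrite (big_nth (a, a)) big_mkord => h.
    rewrite -lte_fin; apply: le_lt_trans h _.
    apply: (@le_lt_trans _ _ (d / 2)%:E); last by rewrite lte_fin; lra.
    apply: le_trans mU; apply: le_measure; rewrite ?inE.
    + by apply: measurableI => //; exact: open_measurable.
    + exact: open_measurable.
    + by move=> z [].
pose S t := [set r | exists2 l, interval_chain U a t l & r = var l].
have S0 t : S t 0 by exists [::] => //; rewrite /var big_nil.
have Sub t : t <= b -> has_ubound (S t).
  by move=> tb; exists e => _ [l ch ->]; exact: var_le ch.
exists (fun t => sup (S t)); split.
- move=> s t _ st tb; apply: ge_sup; first by exists 0.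
  move=> _ [l ch ->]; apply: ub_le_sup (Sub _ tb) _ _.
  by exists l => //; exact: interval_chain_widen ch.
- have h0 : 0 <= sup (S a) by apply: ub_le_sup (Sub _ ab) _ (S0 a).
  rewrite lerBlDr; apply: (@le_trans _ _ e); last by rewrite lerDl.
  by apply: ge_sup; [exists 0 | move=> _ [l ch ->]; exact: var_le ch].
- move=> t Nt at_ tb; near=> s; have ts : t <= s by near: s; exact: nbhs_right_ge.
  have sb : s <= b by near: s; exact: nbhs_right_le.
  have tsU : `[t, s]%classic `<=` U by near: s; apply: open_itv_right => //; exact: NU.
  rewrite lerBrDl -lerBrDr; apply: ge_sup; first by exists 0.
  move=> _ [l ch ->]; rewrite lerBrDr; apply: ub_le_sup (Sub _ sb) _ _.
  by exists ((t, s) :: l) => //; rewrite /var big_cons /= addrC.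
Unshelve. all: by end_near. Qed.

Lemma null_majorizedD a b f g : null_majorized a b f -> null_majorized a b g ->
  null_majorized a b (fun t => f t + g t).
Proof.
move=> fM gM N N0 e e0; have e20 : 0 < e / 2 by rewrite divr_gt0.
have [M [M1 M2 M3]] := fM N N0 _ e20; have [L [L1 L2 L3]] := gM N N0 _ e20.
exists (fun t => M t + L t); split.
- by move=> s t sa st tb; rewrite lerD ?M1 ?L1.
- by lra.
- move=> t Nt at_ tb; near=> s.
  rewrite opprD addrACA (le_trans (ler_normD _ _)) // opprD addrACA lerD //.
  + by near: s; exact: M3.
  + by near: s; exact: L3.
Unshelve. all: by end_near. Qed.

(** Continuous induction: the supremum c of the points up to which the bound
    holds satisfies it by left continuity, and if c < b the bound propagates to
    the right of c. *)
Lemma majorant_increment a b f (M : R -> R) : a <= b ->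
  (forall s t, a <= s -> s <= t -> t <= b -> M s <= M t) ->
  (forall t, a < t -> t <= b -> f s @[s --> t^'-] --> f t) ->
  (forall t, a <= t -> t < b -> \forall s \near t^'+, `|f s - f t| <= M s - M t) ->
  `|f b - f a| <= M b - M a.
Proof.
move=> ab Mmono fleft fstep.
pose S := [set s | [/\ a <= s, s <= b & `|f s - f a| <= M s - M a]].
have Sa : S a by split=> //; rewrite !subrr normr0.
have Sub : has_ubound S by exists b => s [].
have hS : has_sup S by split=> //; exists a.
set c := sup S.
have ac : a <= c by exact: ub_le_sup.
have cb : c <= b by apply: ge_sup; [exists a | move=> s []].
have Sc : S c.
  split=> //; move: ac; rewrite le_eqVlt => /predU1P [<-|ac]; first by have [] := Sa.
  apply/ler_addgt0Pr => e e0.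
  have := fleft c ac cb; move/cvgrPdist_le => /(_ e e0) fe.
  have : \forall s \near c^'-, `|f c - f s| <= e /\ a <= s.
    near=> s; split; first by near: s.
    by near: s; exact: nbhs_left_ge.
  move=> /nbhs_ballP [r /= r0 rP].
  have [s Ss cs] := sup_adherent r0 hS; have [as_ sb fs] := Ss.
  have sc : s <= c by exact: ub_le_sup.
  have Mc : M s <= M c by apply: Mmono.
  have {}fc : `|f c - f s| <= e.
    move: sc; rewrite le_eqVlt => /predU1P [->|sc]; first by rewrite subrr normr0 ltW.
    have /(_ _ sc) [] // := rP s _.
    by rewrite /ball /= ger0_norm ?subr_ge0 ?ltW // ltrBlDr addrC -ltrBlDr.
  rewrite -(subrKA (f s)); apply: le_trans (ler_normD _ _) _.
  by lra.
move: cb; rewrite le_eqVlt => /predU1P [<-|cb]; first by have [] := Sc.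
exfalso; have [] : exists2 s, c < s & S s.
  have := fstep c ac cb; move=> h.
  have : \forall s \near c^'+, [/\ c < s, s <= b & `|f s - f c| <= M s - M c].
    near=> s; split; [|by near: s; exact: nbhs_right_le|by near: s].
    by near: s; exact: nbhs_right_gt.
  move=> /(@filter_ex _ _ (at_right_proper_filter c)) [s [cs sb fs]].
  exists s => //; split; [by rewrite (le_trans ac) // ltW | by [] |].
  rewrite -(subrKA (f c)); apply: le_trans (ler_normD _ _) _.
  by have [_ _ fc] := Sc; lra.
move=> s cs Ss; have : s <= c by exact: ub_le_sup.
by rewrite leNgt cs.
Unshelve. all: by end_near. Qed.

(** Outside the null set the increments to the right are controlled by the
    derivative, and on it by the majorant. *)
Theorem mean_value_ae a b (eta : R) f : a <= b -> 0 <= eta ->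
  null_majorized a b f ->
  (forall t, a < t -> t <= b -> f s @[s --> t^'-] --> f t) ->
  {ae mu, forall t, a <= t -> t < b -> forall e, 0 < e ->
     \forall s \near t^'+, `|f s - f t| <= (eta + e) * (s - t)} ->
  `|f b - f a| <= eta * (b - a).
Proof.
move=> ab eta0 fN fleft [N [mN N0 NP]].
have key e : 0 < e -> `|f b - f a| <= (eta + e) * (b - a) + e.
  move=> e0; have negN : mu.-negligible N by exists N; split.
  have [M [M1 M2 M3]] := fN N negN e e0.
  have ee0 : 0 <= eta + e by rewrite addr_ge0 // ltW.
  have := @majorant_increment a b f (fun t => (eta + e) * t + M t) ab.
  move=> /(_ _ fleft) h.
  have {h} : `|f b - f a| <= (eta + e) * b + M b - ((eta + e) * a + M a).
    apply: h => [s t sa st tb|t at_ tb]; first by rewrite lerD ?M1 ?ler_wpM2l.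
    have [Nt|Nt] := pselect (N t).
      near=> s; have ts : t <= s by near: s; exact: nbhs_right_ge.
      have : `|f s - f t| <= M s - M t by near: s; exact: M3.
      have : 0 <= (eta + e) * (s - t) by rewrite mulr_ge0 // subr_ge0.
      by rewrite mulrBr; lra.
    near=> s; have ts : t <= s by near: s; exact: nbhs_right_ge.
    have sb : s <= b by near: s; exact: nbhs_right_le.
    have : `|f s - f t| <= (eta + e) * (s - t).
      near: s; apply: contrapT => h; apply: Nt; apply: NP => /=.
      by move=> /(_ at_ tb e e0).
    by have := M1 t s at_ ts sb; rewrite mulrBr; lra.
  by rewrite mulrBr; lra.
apply/ler_addgt0Pr => e e0.
have ba : 0 < b - a + 1 by rewrite ltr_wpDl // subr_ge0.
have d0 : 0 < e / (b - a + 1) by rewrite divr_gt0.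
apply: le_trans (key _ d0) _; rewrite mulrDl -addrA lerD2l.
by rewrite -[X in _ + X]mulr1 -mulrDr divfK // gt_eqF.
Unshelve. all: by end_near. Qed.

End NullMajorized.

(** * Derivatives of curves *)

Section Derivatives.
Context {R : realType} {V : normedModType R}.
Implicit Types (f g : R -> V) (l : V) (t : R) (D : set R).

Lemma near_dnbhs_shift t (P : R -> Prop) :
  (\forall h \near 0^', P (h + t)) <-> (\forall s \near t^', P s).
Proof.
split=> /nbhs_ballP [r /= r0 rP]; apply/nbhs_ballP; exists r => //=.
- move=> s ts st; rewrite -(subrK t s); apply: rP.
    by move: ts; rewrite /ball /= sub0r normrN distrC.
  by rewrite subr_eq0.
- move=> h h0r h0; apply: rP; last by rewrite -subr_eq0 addrK.
  by move: h0r; rewrite /ball /= sub0r opprD addrCA subrr addr0.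
Qed.

Lemma growth_rate_le f l s t e : s != t ->
  (`|l - (s - t)^-1 *: (f s - f t)| <= e) =
  (`|f s - f t - (s - t) *: l| <= e * `|s - t|).
Proof.
move=> st; have st0 : s - t != 0 by rewrite subr_eq0.
have -> : f s - f t - (s - t) *: l = (s - t) *: ((s - t)^-1 *: (f s - f t) - l).
  by rewrite scalerBr scalerA divff // scale1r.
by rewrite normrZ mulrC distrC ler_pM2r // normr_gt0.
Qed.

(** The first-order expansion can be restricted to one side or to a subset,
    which relates two-sided derivatives to those taken within a set. *)
Lemma is_deriveP f t l : is_derive t 1 f l <->
  forall e, 0 < e -> \forall s \near t, `|f s - f t - (s - t) *: l| <= e * `|s - t|.
Proof.
pose q h := h^-1 *: ((f \o shift t) (h *: (1 : R)) - f t).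
have qE h : q h = (h + t - t)^-1 *: (f (h + t) - f t).
  by rewrite /q /= [h *: 1]mulr1 addrK.
have P1 : is_derive t 1 f l <-> q h @[h --> 0^'] --> l.
  split=> [[fd <-]|ql]; first exact: fd.
  by split; [apply/cvg_ex; exists l | exact: cvg_lim ql].
have P2 : q h @[h --> 0^'] --> l <-> forall e, 0 < e ->
    \forall s \near t^', `|l - (s - t)^-1 *: (f s - f t)| <= e.
  split=> [/cvgrPdist_le h e /h he|h].
    by apply/near_dnbhs_shift; apply: filterS he => k; rewrite -qE.
  apply/cvgrPdist_le => e /h /near_dnbhs_shift he.
  by apply: filterS he => k; rewrite -qE.
rewrite P1 P2; split=> h e e0; have := h e e0.
- move=> /nbhs_ballP [r /= r0 rP]; apply/nbhs_ballP; exists r => //= s ts.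
  have [->|st] := eqVneq s t; first by rewrite !subrr scale0r subrr !normr0 mulr0.
  by rewrite -growth_rate_le //; exact: rP.
- move=> /nbhs_ballP [r /= r0 rP]; apply/nbhs_ballP; exists r => //= s ts st.
  by rewrite growth_rate_le //; exact: rP.
Qed.

Lemma derivable_withinP D f t : derivable_within D f t ->
  forall e, 0 < e -> \forall s \near t, D s ->
    `|f s - f t - (s - t) *: derive_within D f t| <= e * `|s - t|.
Proof.
move=> fd e e0; have {fd} := fd : cvg_to _ _.
move/cvgrPdist_le => /(_ e e0) /nbhs_ballP [r /= r0 rP].
apply/nbhs_ballP; exists r => //= s ts Ds.
have [->|st] := eqVneq s t; first by rewrite !subrr scale0r subrr !normr0 mulr0.
by rewrite -growth_rate_le //; exact: rP.
Qed.

Lemma derivable_within_lipschitz D f t : derivable_within D f t ->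
  exists2 C, 0 <= C & \forall s \near t, D s -> `|f s - f t| <= C * `|s - t|.
Proof.
move=> fd; exists (`|derive_within D f t| + 1); first by rewrite addr_ge0.
have := derivable_withinP fd ltr01; apply: filterS => s h /h {}h.
rewrite -(subrK ((s - t) *: derive_within D f t) (f s - f t)).
apply: le_trans (ler_normD _ _) _; rewrite mulrDl addrC lerD //.
by rewrite normrZ mulrC.
Qed.

Lemma near_itvcy (t0 t : R) : t0 < t -> \forall s \near t, `[t0, +oo[%classic s.
Proof.
move=> tt; near=> s; rewrite /= in_itv /= andbT ltW //.
by near: s; exact: lt_nbhsr.
Unshelve. all: by end_near. Qed.

Lemma derivable_within_is_derive (t0 : R) f t : t0 < t ->
  derivable_within `[t0, +oo[%classic f t ->
  is_derive t 1 f (derive_within `[t0, +oo[%classic f t).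
Proof.
move=> tt fd; apply/is_deriveP => e e0.
near=> s; have : `[t0, +oo[%classic s by near: s; exact: near_itvcy.
by near: s; exact: derivable_withinP.
Unshelve. all: by end_near. Qed.

Lemma is_derive_cvg f t l : is_derive t 1 f l -> f s @[s --> t] --> f t.
Proof.
move=> [fd _]; exact/differentiable_continuous/derivable1_diffP.
Qed.

Lemma lipschitz_within_cvg D f t C :
  (\forall s \near t, D s -> `|f s - f t| <= C * `|s - t|) ->
  f s @[s --> within D (nbhs t)] --> f t.
Proof.
move=> fC; apply/cvgrPdist_le => e e0; rewrite near_withinE.
have C0 : 0 < `|C| + 1 by rewrite ltr_wpDl.
near=> s; move=> Ds; rewrite distrC.
have : `|f s - f t| <= C * `|s - t| by move: Ds; near: s.
move=> /le_trans; apply; apply: (@le_trans _ _ ((`|C| + 1) * `|s - t|)).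
  by rewrite ler_wpM2r // (le_trans (ler_norm C)) // lerDl.
rewrite mulrC -ler_pdivlMr // distrC.
by near: s; apply: cvgr_dist_le; rewrite ?divr_gt0 //; exact: cvg_id.
Unshelve. all: by end_near. Qed.

Lemma derivable_within_cvg D f t : derivable_within D f t ->
  f s @[s --> within D (nbhs t)] --> f t.
Proof. by move=> /derivable_within_lipschitz [C _ /lipschitz_within_cvg]. Qed.

End Derivatives.

Section RealDerivatives.
Context {R : realType}.
Implicit Types (f g : R -> R) (t T : R).

Lemma is_derive_squeeze (lo f hi : R -> R) t (l : R) :
  (\forall s \near t, lo s <= f s <= hi s) -> lo t = f t -> hi t = f t ->
  is_derive t 1 lo l -> is_derive t 1 hi l -> is_derive t 1 f l.
Proof.
move=> lfh lot hit /is_deriveP dlo /is_deriveP dhi; apply/is_deriveP => e e0.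
near=> s.
have /andP[h1 h2] : lo s <= f s <= hi s by near: s.
have : `|lo s - lo t - (s - t) *: l| <= e * `|s - t| by near: s; exact: dlo.
have : `|hi s - hi t - (s - t) *: l| <= e * `|s - t| by near: s; exact: dhi.
rewrite lot hit !ler_norml => /andP[h3 h4] /andP[h5 h6]; apply/andP; split; lra.
Unshelve. all: by end_near. Qed.

(** The derivation rules in pointwise form, from which the derivative of an
    explicit expression is assembled as a term. *)
Lemma is_derive_mul f g t (df dg : R) : is_derive t 1 f df -> is_derive t 1 g dg ->
  is_derive t 1 (fun s => f s * g s) (df * g t + f t * dg).
Proof.
move=> Df Dg; apply: (is_derive_eq (is_deriveM Df Dg)).
by rewrite /GRing.scale /= addrC; ring.
Qed.

Lemma is_derive_add f g t (df dg : R) : is_derive t 1 f df -> is_derive t 1 g dg ->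
  is_derive t 1 (fun s => f s + g s) (df + dg).
Proof. by move=> Df Dg; exact: is_deriveD. Qed.

Lemma is_derive_sub f g t (df dg : R) : is_derive t 1 f df -> is_derive t 1 g dg ->
  is_derive t 1 (fun s => f s - g s) (df - dg).
Proof. by move=> Df Dg; exact: is_deriveB. Qed.

Lemma is_derive_const (c : R) t : is_derive t 1 (fun=> c) (0 : R).
Proof. exact: is_derive_cst. Qed.

Lemma is_derive_idfun t : is_derive t 1 (fun s : R => s) (1 : R).
Proof. exact: is_derive_id. Qed.

Lemma is_derive_inv f t (df : R) : f t != 0 -> is_derive t 1 f df ->
  is_derive t 1 (fun s => (f s)^-1) (- (f t) ^- 2 * df).
Proof.
move=> ft [fd fE]; split; first exact: derivableV.
by rewrite deriveV // fE.
Qed.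

Lemma is_derive_nonincreasing f (df : R -> R) T :
  (forall t, T <= t -> is_derive t 1 f (df t)) ->
  (forall t, T <= t -> df t <= 0) ->
  forall s t, T <= s -> s <= t -> f t <= f s.
Proof.
move=> Df df0 s t Ts st.
have [||c cst] := @MVT_segment _ f df s t st.
- by move=> z; rewrite in_itv /= => /andP[/ltW sz _]; apply: Df; exact: le_trans sz.
- apply: derivable_within_continuous => z; rewrite in_itv /= => /andP[sz _].
  by have [] := Df z (le_trans Ts sz).
rewrite -subr_le0 => ->; rewrite mulr_le0_ge0 ?subr_ge0 // df0 //.
by move: cst; rewrite in_itv /= => /andP[sc _]; exact: le_trans sc.
Qed.

Lemma nonincreasing_bounded_cvg f T (m : R) :
  (forall s t, T <= s -> s <= t -> f t <= f s) -> (forall t, T <= t -> m <= f t) ->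
  exists l : R, f t @[t --> +oo] --> l.
Proof.
move=> fdec fm; pose h t := - f (Num.max t T).
have hT t : T <= Num.max t T by rewrite le_max lexx orbT.
have : h t @[t --> +oo] --> sup (range h).
  apply: nondecreasing_cvgr.
    move=> s t st; rewrite /h lerN2 fdec // ge_max le_max st /= hT.
    by [].
  by exists (- m) => _ [t _ <-]; rewrite lerN2 fm.
move=> /cvgN hl; exists (- sup (range h)); apply: cvg_trans hl.
apply: near_eq_cvg; near=> t; rewrite /= opprK max_l //.
Unshelve. all: by end_near. Qed.

End RealDerivatives.

Section InnerProductDerivative.
Context {R : realType} {H : normedModType R} (ip : {dot H for idfun}).
Hypothesis ip_norm : forall u : H, ip u u = `|u| ^+ 2.

Lemma is_derive_ip (u v : R -> H) (t : R) (du dv : H) :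
  is_derive t 1 u du -> is_derive t 1 v dv ->
  is_derive t 1 (fun s => ip (u s) (v s)) (ip du (v t) + ip (u t) dv).
Proof.
move=> Du Dv.
pose q (f : R -> H) h := h^-1 *: ((f \o shift t) (h *: (1 : R)) - f t).
have qu : q u h @[h --> 0^'] --> du by case: Du => fd <-; exact: fd.
have qv : q v h @[h --> 0^'] --> dv by case: Dv => fd <-; exact: fd.
have vs : (v \o shift t) (h *: (1 : R)) @[h --> 0^'] --> v t.
  apply: (@cvg_comp _ _ _ (fun h : R => h *: (1 : R) + t) v _ (nbhs t)).
    move=> P tP; have /near_dnbhs_shift : \forall s \near t^', P s by exact: nbhs_dnbhs.
    by apply: filterS => h hP; rewrite /= [h *: _]mulr1.
  exact: is_derive_cvg Dv.
have lim_q : h^-1 *: (((fun s => ip (u s) (v s)) \o shift t) (h *: (1 : R)) -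
    ip (u t) (v t)) @[h --> 0^'] --> ip du (v t) + ip (u t) dv.
  under eq_cvg => h.
    have -> : h^-1 *: (((fun s => ip (u s) (v s)) \o shift t) (h *: (1 : R))
        - ip (u t) (v t)) =
        ip (q u h) ((v \o shift t) (h *: (1 : R))) + ip (u t) (q v h).
      rewrite /q /= !ipE /GRing.scale /=; ring.
    over.
  by apply: cvgD; apply: (cvg_ip ip_norm) => //; exact: cvg_cst.
by split; [apply/cvg_ex; eexists; exact: lim_q | exact: cvg_lim lim_q].
Qed.

End InnerProductDerivative.

(** * Regularity along the trajectory *)

Lemma abs_continuous_subitv {R : realType} {V : normedModType R} (f : R -> V)
    (a b c d : R) : a <= c -> d <= b ->
  abs_continuous a b f -> abs_continuous c d f.
Proof.
move=> ac db fac e /fac [del del0 delP]; exists del => // n u v uv; apply: delP => i.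
have [cu [uvi vd]] := uv i; split; first exact: le_trans cu.
by split=> //; exact: le_trans vd db.
Qed.

Lemma within_cvg_interior {R : realType} {T : topologicalType} (t0 t : R)
    (f : R -> T) (l : T) : t0 < t ->
  f s @[s --> within `[t0, +oo[%classic (nbhs t)] --> l -> f s @[s --> t] --> l.
Proof.
move=> tt h P /h hP.
have : \forall s \near within `[t0, +oo[%classic (nbhs t), P (f s) by exact: hP.
rewrite near_withinE => fP.
suff : \forall s \near t, P (f s) by [].
near=> s; have Ds : `[t0, +oo[%classic s by near: s; exact: near_itvcy.
by move: Ds; near: s.
Unshelve. all: by end_near. Qed.

Section Trajectory.
Context {R : realType} {H : completeNormedModType R} (ip : {dot H for idfun}).
Hypothesis ip_norm : forall u : H, ip u u = `|u| ^+ 2.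
Context (Phi : H -> \bar R).
Hypothesis Phi_proper : proper_ereal Phi.
Hypothesis Phi_convex : convex_ereal Phi.
Hypothesis Phi_lsc : lower_semicontinuous Phi.
Hypothesis Phi_argmin : argmin Phi !=set0.
Context (t0 : R) (lambda : R -> R) (x : R -> H).
Local Notation D := `[t0, +oo[%classic.
Hypothesis lambda_gt0 : forall t, t0 <= t -> 0 < lambda t.
Hypothesis lambda_ndecr : forall s t, t0 <= s -> s <= t -> lambda s <= lambda t.
Hypothesis lambda_derivable : forall t, t0 <= t -> derivable_within D lambda t.
Hypothesis x_derivable : forall t, t0 <= t -> derivable_within D x t.

Implicit Types t s : R.
Local Notation g t := (grad_moreau ip Phi (lambda t) (x t)).
Local Notation gap t := (moreau Phi (lambda t) (x t) - min_value Phi).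
Local Notation dx := (derive_within D x).
Local Notation dlambda := (derive_within D lambda).

Let gE t : t0 <= t -> g t = yosida Phi (lambda t) (x t).
Proof. by move=> tt; rewrite (grad_moreauE ip_norm) // lambda_gt0. Qed.

(** As lambda is merely differentiable, its difference quotients are bounded
    near each t but not uniformly in t, and so are those of g. *)
Lemma grad_trajectory_lipschitz t : t0 <= t -> exists2 C, 0 <= C &
  \forall s \near t, D s -> `|g s - g t| <= C * `|s - t|.
Proof.
move=> tt; have [Cx Cx0 xP] := derivable_within_lipschitz (x_derivable tt).
have [Cl Cl0 lP] := derivable_within_lipschitz (lambda_derivable tt).
have l0 := lambda_gt0 (lexx t0).
exists ((Cx + Cl * `|g t|) / lambda t0).
  by rewrite divr_ge0 ?addr_ge0 ?mulr_ge0 // ltW.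
near=> s; move=> Ds; have ts : t0 <= s by move: Ds; rewrite /= in_itv /= andbT.
have xs : `|x s - x t| <= Cx * `|s - t| by move: Ds; near: s.
have ls : `|lambda s - lambda t| <= Cl * `|s - t| by move: Ds; near: s.
have := yosida_lipschitz ip_norm Phi_proper Phi_convex Phi_lsc Phi_argmin
  (x t) (x s) (lambda_gt0 tt) (lambda_gt0 ts).
rewrite -!gE // => h.
rewrite mulrAC ler_pdivlMr // mulrC.
apply: (@le_trans _ _ (lambda s * `|g s - g t|)).
  by rewrite ler_wpM2r // lambda_ndecr.
apply: le_trans h _; rewrite mulrDl lerD // mulrAC.
by rewrite ler_wpM2r.
Unshelve. all: by end_near. Qed.

Lemma grad_trajectory_cvg t : t0 <= t -> g s @[s --> within D (nbhs t)] --> g t.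
Proof.
by move=> /grad_trajectory_lipschitz [C _ /lipschitz_within_cvg].
Qed.

(** The affine minorant of the envelope at time t, and the proximal objective
    evaluated at the proximal point of time t, enclose the envelope; along the
    trajectory both are differentiable at t, with the same value and the same
    derivative. *)
Lemma gap_is_derive t : t0 < t ->
  is_derive t 1 (fun s => gap s) (ip (g t) (dx t) - dlambda t / 2 * `|g t| ^+ 2).
Proof.
move=> tt; have tt' := ltW tt; have lt0 := lambda_gt0 tt'.
have Dx := derivable_within_is_derive tt (x_derivable tt').
have Dl := derivable_within_is_derive tt (lambda_derivable tt').
have gt_ := gE tt'.
set p := prox Phi (lambda t) (x t).
have xp : x t - p = lambda t *: g t by rewrite gt_ -sub_proxE // gt_eqF.
pose M := moreau Phi (lambda t) (x t).
pose lo s := M + ip (g t) (x s - x t) - (lambda s - lambda t) * (`|g t| ^+ 2 / 2)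
  - min_value Phi.
pose hi s := fine (Phi p) + (2 * lambda s)^-1 * ip (x s - p) (x s - p) - min_value Phi.
apply: (@is_derive_squeeze _ lo _ hi).
- near=> s; have ts : t0 <= s by apply: ltW; near: s; exact: lt_nbhsr.
  have ls0 := lambda_gt0 ts; rewrite /lo /hi !lerD2r; apply/andP; split.
    have := moreau_ge_tangent ip_norm Phi_proper Phi_convex Phi_lsc Phi_argmin
      (x t) (x s) lt0 ls0.
    by rewrite -gt_ /M; congr (_ - _ <= _); ring.
  rewrite ip_norm.
  have pfin := prox_fin_num ip_norm Phi_proper Phi_convex Phi_lsc Phi_argmin (x t) lt0.
  exact: (moreau_le ip_norm) pfin.
- by rewrite /lo !subrr (linear0 (ip _)) mul0r subr0 addr0.
- by rewrite /hi ip_norm /= (moreauE ip_norm).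
- have D1 := is_derive_ip ip_norm (is_derive_cst (g t) t 1)
    (is_deriveB Dx (is_derive_cst (x t) t 1)).
  have D2 := is_derive_mul (is_derive_sub Dl (is_derive_const (lambda t) t))
    (is_derive_const (`|g t| ^+ 2 / 2) t).
  apply: (is_derive_eq (is_derive_sub (is_derive_sub (is_derive_add
    (is_derive_const M t) D1) D2) (is_derive_const (min_value Phi) t))).
  rewrite /= !subr0 (linear0l ip); ring.
- have Dxp := is_deriveB Dx (is_derive_cst p t 1).
  have D1 := is_derive_ip ip_norm Dxp Dxp.
  have l20 : 2 * lambda t != 0 by rewrite mulf_neq0 // gt_eqF.
  have D2 := @is_derive_inv _ (fun s => 2 * lambda s) t _ l20
    (is_derive_mul (is_derive_const (2 : R) t) Dl).
  apply: (is_derive_eq (is_derive_sub (is_derive_add (is_derive_const (fine (Phi p)) t)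
     (is_derive_mul D2 D1)) (is_derive_const (min_value Phi) t))).
  rewrite !subr0 -[(x - cst p) t]/(x t - p) xp !ipE !ip_norm (ipC ip (dx t)).
  field; rewrite gt_eqF //.
Unshelve. all: by end_near. Qed.

Context (alpha beta : R) (b eps : R -> R).
Hypothesis t0_gt0 : 0 < t0.
Hypothesis beta_gt0 : 0 < beta.
Hypothesis b_derivable : forall t, t0 <= t -> derivable_within D b t.
Hypothesis eps_derivable : forall t, t0 <= t -> derivable_within D eps t.
Hypothesis dx_continuous : {within D, continuous dx}.
Hypothesis dx_ac : forall T, t0 <= T -> abs_continuous t0 T dx.
Hypothesis x_equation : {ae lebesgue_measure, forall t, D t ->
  [/\ derivable_within D dx t, derivable_within D (fun s => g s) t &
    derive_within D dx t + (alpha / t) *: dx t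
    + beta *: derive_within D (fun s => g s) t + b t *: g t + eps t *: x t = 0]}.

Local Notation w t := (dx t + beta *: g t).
(* The derivative of w that the equation prescribes. *)
Local Notation force t := (- ((alpha / t) *: dx t + b t *: g t + eps t *: x t)).

Lemma derivable_interior_cvg {V : normedModType R} (f : R -> V) t : t0 < t ->
  derivable_within D f t -> f s @[s --> t] --> f t.
Proof. by move=> tt /(derivable_within_is_derive tt); exact: is_derive_cvg. Qed.

Lemma dx_cvg t : t0 < t -> dx s @[s --> t] --> dx t.
Proof.
move=> tt; have [dxc _] := (continuous_within_itvcyP _ _).1 dx_continuous.
by apply: dxc; rewrite in_itv /= tt.
Qed.

Lemma grad_cvg t : t0 < t -> g s @[s --> t] --> g t.
Proof.
by move=> tt; exact: within_cvg_interior tt (grad_trajectory_cvg (ltW tt)).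
Qed.

Lemma force_cvg t : t0 < t -> force s @[s --> t] --> force t.
Proof.
move=> tt; have tt' := ltW tt; have tn0 : t != 0 by rewrite gt_eqF // (lt_trans t0_gt0).
apply: cvgN; apply: cvgD; first apply: cvgD.
- apply: cvgZ; last exact: dx_cvg.
  by apply: cvgM; [exact: cvg_cst | apply: cvgV => //; exact: cvg_id].
- apply: cvgZ; last exact: grad_cvg.
  exact: derivable_interior_cvg tt (b_derivable tt').
- apply: cvgZ; last exact: derivable_interior_cvg tt (x_derivable tt').
  exact: derivable_interior_cvg tt (eps_derivable tt').
Qed.

(** The mean value inequality for w s - s *: force t, which is the sum of an
    absolutely continuous function and a pointwise Lipschitz one and has the
    derivative force s - force t almost everywhere. *)
Lemma velocity_increment t (c d e : R) : t0 < c -> c <= d -> 0 < e ->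
  (forall s, c <= s -> s <= d -> `|force s - force t| <= e) ->
  `|(w d - d *: force t) - (w c - c *: force t)| <= e * (d - c).
Proof.
move=> tc cd e0 fe.
apply: (@mean_value_ae _ _ c d e (fun s => w s - s *: force t)) => //.
- exact: ltW.
- have -> : (fun s => w s - s *: force t) =
     (fun s => dx s + (beta *: g s - s *: force t)).
    by apply/funext => s; rewrite addrA.
  apply: null_majorizedD.
    apply: abs_continuous_null_majorized => //.
    apply: (abs_continuous_subitv _ (lexx d) (dx_ac _)); first exact: ltW.
    by rewrite (le_trans (ltW tc)).
  apply: pointwise_lipschitz_null_majorized => // s cs sd.
  have ts : t0 < s by exact: lt_le_trans cs.
  have [C C0 CP] := grad_trajectory_lipschitz (ltW ts).
  exists (beta * C + `|force t|); near=> z.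
  have sz : s <= z by near: z; exact: nbhs_right_ge.
  have Dz : D z by rewrite /= in_itv /= andbT (le_trans (ltW ts)).
  have gz : `|g z - g s| <= C * `|z - s|.
    by move: Dz; near: z; exact: cvg_within CP.
  rewrite (ger0_norm (_ : 0 <= z - s)) ?subr_ge0 // in gz.
  have -> : beta *: g z - z *: force t - (beta *: g s - s *: force t) =
     beta *: (g z - g s) - (z - s) *: force t.
    by rewrite scalerBr scalerBl !opprD !opprK addrACA.
  apply: le_trans (ler_normB _ _) _; rewrite !normrZ mulrDl lerD //.
    by rewrite gtr0_norm // -mulrA ler_wpM2l // ltW.
  by rewrite mulrC ger0_norm // subr_ge0.
- move=> s cs sd; have ts : t0 < s by exact: lt_trans cs.
  apply: cvg_at_left_filter; apply: cvgB.
    by apply: cvgD; [exact: dx_cvg | apply: cvgZ; [exact: cvg_cst | exact: grad_cvg]].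
  by apply: cvgZ; [exact: cvg_id | exact: cvg_cst].
- have [N [mN N0 NP]] := x_equation; exists N; split=> // s ns.
  apply: NP => /= eqn; apply: ns => cs sd e' e'0.
  have ts : t0 < s by exact: lt_le_trans cs.
  have Ds : D s by rewrite /= in_itv /= andbT ltW.
  have [Ddx Dg eq0] := eqn Ds.
  have := is_deriveD (derivable_within_is_derive ts Ddx)
    (is_deriveZ beta (derivable_within_is_derive ts Dg)).
  have -> : derive_within D dx s + beta *: derive_within D (fun r => g r) s = force s.
    apply/eqP; rewrite -subr_eq0 opprK; apply/eqP; rewrite -[RHS]eq0 !addrA.
    by rewrite [X in X + _ + _ = _]addrAC.
  move=> /is_deriveP /(_ e' e'0) Dw.
  near=> z; have sz : s <= z by near: z; exact: nbhs_right_ge.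
  have : `|w z - w s - (z - s) *: force s| <= e' * `|z - s|.
    by near: z; exact: cvg_within Dw.
  rewrite (ger0_norm (_ : 0 <= z - s)) ?subr_ge0 // => wz.
  have -> : w z - z *: force t - (w s - s *: force t) =
      (z - s) *: (force s - force t) + (w z - w s - (z - s) *: force s).
    move: (w z) (w s) (force s) (force t) => A B F F'.
    by rewrite scalerBr [RHS]addrC addrA subrK scalerBl !opprD !opprK addrACA.
  apply: le_trans (ler_normD _ _) _; rewrite mulrDl lerD //.
  by rewrite normrZ ger0_norm ?subr_ge0 // mulrC ler_wpM2r ?subr_ge0 // fe // ltW.
Unshelve. all: by end_near. Qed.

(** The equation gives the derivative of w almost everywhere, and the right-hand
    side is continuous. As the increments of w are controlled by its almost
    everywhere derivative, w is differentiable everywhere. *)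
Lemma velocity_is_derive t : t0 < t -> is_derive t 1 (fun s => w s) (force t).
Proof.
move=> tt; apply/is_deriveP => e e0.
have : \forall s \near t, `|force s - force t| <= e /\ t0 < s.
  have := force_cvg tt; move/cvgrPdist_le => /(_ e e0) fe.
  near=> s; split; last by near: s; exact: lt_nbhsr.
  by rewrite distrC; near: s; exact: fe.
move=> /nbhs_ballP [r /= r0 rP]; apply/nbhs_ballP; exists r => //= s.
have step c d : c <= d -> ball t r c -> ball t r d ->
    `|w d - w c - (d - c) *: force t| <= e * `|d - c|.
  move=> cd tc td.
  have -> : w d - w c - (d - c) *: force t =
      (w d - d *: force t) - (w c - c *: force t).
    move: (w d) (w c) (force t) => A B F.
    by rewrite scalerBl !opprD !opprK addrACA.
  rewrite (ger0_norm (_ : 0 <= d - c)) ?subr_ge0 //.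
  apply: velocity_increment => // [|z cz zd]; first by have [] := rP c tc.
  have /rP [] // : ball t r z.
  move: tc td; rewrite /ball /= !ltr_distlC => /andP[h1 h2] /andP[h3 h4].
  by apply/andP; split; [exact: lt_le_trans h1 cz | exact: le_lt_trans zd h4].
move=> ts; have [st|/ltW st] := leP s t; last by apply: step => //; exact: ballxx.
have h := step _ _ st ts (ballxx t r0).
rewrite (distrC s t); apply: le_trans h; rewrite le_eqVlt; apply/orP; left; apply/eqP.
move: (w s) (w t) (force t) => A B F.
by rewrite -normrN !opprD !opprK -[in RHS]scaleNr opprB [- A + B]addrC.
Unshelve. all: by end_near. Qed.

End Trajectory.

(** * Lyapunov analysis *)

(** The trajectory from time T on, with z a minimizer, gap the excess of the
    envelope over the minimal value, db, deps and dl the derivatives of b, eps and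
    lambda, and P a primitive of t eps(t), bounded because that weight is
    integrable. The slack c0 of b over 1/a and the choice T >= 2 beta / c0 make
    the terms in |g|^2 dissipative. *)
Section Lyapunov.
Context {R : realType} {H : normedModType R} (ip : {dot H for idfun}).
Hypothesis ip_norm : forall u : H, ip u u = `|u| ^+ 2.
Context (alpha beta a delta c0 T PB : R) (z : H).
Context (x dx g : R -> H) (gap b eps P : R -> R) (db deps dl : R -> R).
Implicit Types t s q : R.
Local Notation w t := (dx t + beta *: g t).

Hypothesis alpha_gt3 : 3 < alpha.
Hypothesis beta_gt0 : 0 < beta.
Hypothesis a_gt0 : 0 < a.
Hypothesis delta_gt0 : 0 < delta.
Hypothesis delta_lt : delta < alpha - 3.
Hypothesis c0_gt0 : 0 < c0.
Hypothesis T_gt0 : 0 < T.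
Hypothesis T_large : 2 * beta <= T * c0.
Hypothesis Dx : forall t, T <= t -> is_derive t 1 x (dx t).
Hypothesis Dw : forall t, T <= t -> is_derive t 1 (fun s => w s)
  (- ((alpha / t) *: dx t + b t *: g t + eps t *: x t)).
Hypothesis Dgap : forall t, T <= t ->
  is_derive t 1 gap (ip (g t) (dx t) - dl t / 2 * `|g t| ^+ 2).
Hypothesis Db : forall t, T <= t -> is_derive t 1 b (db t).
Hypothesis Deps : forall t, T <= t -> is_derive t 1 eps (deps t).
Hypothesis DP : forall t, T <= t -> is_derive t 1 P (t * eps t).
Hypothesis P_le : forall t, T <= t -> P t <= PB.
Hypothesis dl_ge0 : forall t, T <= t -> 0 <= dl t.
Hypothesis gap_ge0 : forall t, T <= t -> 0 <= gap t.
Hypothesis gap_le : forall t, T <= t -> gap t <= ip (g t) (x t - z).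
Hypothesis eps_ge0 : forall t, T <= t -> 0 <= eps t.
Hypothesis deps_le : forall t, T <= t -> 2 * deps t <= - a * beta * eps t ^+ 2.
Hypothesis tb_ge : forall t, T <= t -> beta <= t * b t.
Hypothesis b_ge : forall t, T <= t -> a^-1 + c0 <= b t.
Hypothesis growth : forall t, T <= t -> delta * t * b t <=
  (alpha - 3) * t * b t - t ^+ 2 * db t + beta * (2 - alpha).

Definition psi q t := (t ^+ 2 * b t - beta * (q + 2 - alpha) * t) * gap t
  + t ^+ 2 * eps t / 2 * `|x t| ^+ 2 + t ^+ 2 / 2 * `|w t| ^+ 2.

(** An expanded form, differentiated term by term, of a sum of non-negative
    terms; see energyE. *)
Definition energy q t := psi q t + q * t * ip (x t - z) (w t)
  + q * (alpha - 1) / 2 * `|x t - z| ^+ 2.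

Definition denergy q t :=
  (2 * t * b t + t ^+ 2 * db t - beta * (q + 2 - alpha)) * gap t
  - q * (t * b t - beta) * ip (g t) (x t - z)
  - q * t * eps t * ip (x t) (x t - z)
  - t * (alpha - 1 - q) * `|dx t| ^+ 2
  - (t * b t - beta) * t * beta * `|g t| ^+ 2
  - t ^+ 2 * eps t * beta * ip (x t) (g t)
  - (t ^+ 2 * b t - beta * (q + 2 - alpha) * t) * (dl t / 2) * `|g t| ^+ 2
  + (t * eps t + t ^+ 2 * deps t / 2) * `|x t| ^+ 2.

Let t_gt0 t : T <= t -> 0 < t.
Proof. by move=> h; exact: lt_le_trans h. Qed.

Lemma is_derive_sqr t : is_derive t 1 (fun s : R => s ^+ 2) (2 * t).
Proof.
apply: (is_derive_eq (is_derive_mul (is_derive_idfun t) (is_derive_idfun t))); ring.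
Qed.

(** The multiples of <g, x'>, <x, x'> and <x - z, x'> cancel, which is what the
    coefficients of the energy are chosen for. *)
Lemma energy_is_derive q t : T <= t -> is_derive t 1 (energy q) (denergy q t).
Proof.
move=> tT; have t0 := t_gt0 tT.
have Dy : is_derive t 1 (fun s => x s - z) (dx t).
  by apply: (is_derive_eq (is_deriveB (Dx tT) (is_derive_cst z t 1))); rewrite subr0.
have Dw' := Dw tT.
have D1 := is_derive_mul (is_derive_sub (is_derive_mul (is_derive_sqr t) (Db tT))
  (is_derive_mul (is_derive_const (beta * (q + 2 - alpha)) t) (is_derive_idfun t)))
  (Dgap tT).
have D2 := is_derive_mul (is_derive_mul (is_derive_mul (is_derive_sqr t) (Deps tT))
  (is_derive_const (2^-1) t)) (is_derive_ip ip_norm (Dx tT) (Dx tT)).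
have D3 := is_derive_mul (is_derive_mul (is_derive_sqr t) (is_derive_const (2^-1) t))
  (is_derive_ip ip_norm Dw' Dw').
have D4 := is_derive_mul (is_derive_mul (is_derive_const q t) (is_derive_idfun t))
  (is_derive_ip ip_norm Dy Dw').
have D5 := is_derive_mul (is_derive_const (q * (alpha - 1) / 2) t)
  (is_derive_ip ip_norm Dy Dy).
have -> : energy q = (fun s =>
  (s ^+ 2 * b s - beta * (q + 2 - alpha) * s) * gap s
  + s ^+ 2 * eps s * 2^-1 * ip (x s) (x s) + s ^+ 2 * 2^-1 * ip (w s) (w s)
  + q * s * ip (x s - z) (w s) + q * (alpha - 1) / 2 * ip (x s - z) (x s - z)).
  by apply/funext => s; rewrite /energy /psi !ip_norm.
apply: (is_derive_eq (is_derive_add (is_derive_add (is_derive_add (is_derive_add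
  D1 D2) D3) D4) D5)).
rewrite /denergy.
move: (x t - z) => y; move: (x t) (dx t) (g t) => X V G.
rewrite !ipE -!ip_norm (ipC ip V G) (ipC ip X V) (ipC ip X G).
rewrite (ipC ip y V) (ipC ip y G) (ipC ip y X).
by field; rewrite gt_eqF.
Qed.

(** Convexity trades the pairing (t b - beta) <g, x - z> for the gap, except for a
    share k of it, and the growth condition then bounds the coefficient of the
    gap. The terms in eps lose their sign only through <x, g> and <x, z>. The
    first is absorbed by completing a square, thanks to the decay of eps and at
    the cost of t^2 beta / a |g|^2, which the slack c0 pays for; the second leaves
    the multiple of t eps(t). *)
Lemma denergy_le q k t : T <= t -> 0 <= k -> k <= q -> 2 <= q -> q <= alpha - 1 ->
  denergy q t <= (alpha - 1 - q - delta + k) * (t * b t * gap t)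
    - k * ((t * b t - beta) * ip (g t) (x t - z))
    - t * (alpha - 1 - q) * `|dx t| ^+ 2
    - beta * c0 / 2 * (t ^+ 2 * `|g t| ^+ 2)
    + q / 2 * `|z| ^+ 2 * (t * eps t).
Proof.
move=> tT k0 kq q2 qa; have t0 := t_gt0 tT.
have gp0 := gap_ge0 tT; have gpl := gap_le tT; have tb := tb_ge tT.
have e0 := eps_ge0 tT; have l0 := dl_ge0 tT.
set h := ip (g t) (x t - z) in gpl *.
(* Convexity, for the share q - k of the pairing. *)
have H1 : 0 <= (q - k) * (t * b t - beta) * (h - gap t).
  by rewrite !mulr_ge0 ?subr_ge0.
(* Polarization of <x, x - z>, followed by q >= 2. *)
have H2 : 0 <= t * eps t * (q / 2 * (`|z| ^+ 2 - `|x t| ^+ 2) + q * ip (x t) (x t - z)).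
  apply: mulr_ge0; first by rewrite mulr_ge0 // ltW.
  have -> : q / 2 * (`|z| ^+ 2 - `|x t| ^+ 2) + q * ip (x t) (x t - z) =
      q / 2 * `|x t - z| ^+ 2.
    by rewrite (normB_sqr ip_norm) !ipE ip_norm; field.
  by apply: mulr_ge0; [lra | exact: sqr_ge0].
have H3 : 0 <= t * eps t * ((q - 2) / 2 * `|x t| ^+ 2).
  apply: mulr_ge0; first by rewrite mulr_ge0 // ltW.
  by apply: mulr_ge0; [lra | exact: sqr_ge0].
(* beta / a |g + (a eps / 2) x|^2 >= 0 and the decay of eps. *)
have H4 : 0 <= t ^+ 2 * (beta / a * `|g t| ^+ 2 + eps t * beta * ip (x t) (g t)
    - deps t / 2 * `|x t| ^+ 2).
  rewrite mulr_ge0 ?sqr_ge0 //.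
  have : 0 <= beta / a * `|(a * eps t / 2) *: x t + g t| ^+ 2.
    by rewrite mulr_ge0 ?sqr_ge0 // divr_ge0 // ltW.
  rewrite (normD_sqr ip_norm) (normZ_sqr ip_norm) ipZl.
  have : 0 <= (- a * beta * eps t ^+ 2 - 2 * deps t) / 4 * `|x t| ^+ 2.
    by rewrite mulr_ge0 ?sqr_ge0 // divr_ge0 // subr_ge0 deps_le.
  move: (ip (x t) (g t)) (`|x t| ^+ 2) (`|g t| ^+ 2) => I N G h1 h2.
  have h3 := addr_ge0 h1 h2; apply: le_trans h3 _.
  by rewrite le_eqVlt; apply/orP; left; apply/eqP; field; rewrite gt_eqF.
have H5 : 0 <= (t ^+ 2 * b t - beta * (q + 2 - alpha) * t) * (dl t / 2) * `|g t| ^+ 2.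
  rewrite mulr_ge0 ?sqr_ge0 // mulr_ge0 ?divr_ge0 //.
  have -> : t ^+ 2 * b t - beta * (q + 2 - alpha) * t =
    t * ((t * b t - beta) + beta * (alpha - 1 - q)) by ring.
  apply: mulr_ge0; first exact: ltW.
  by apply: addr_ge0; [lra | rewrite mulr_ge0 ?subr_ge0 // ltW].
have H6 : 0 <= t ^+ 2 * beta * (b t - a^-1 - c0) * `|g t| ^+ 2.
  apply: mulr_ge0; last exact: sqr_ge0.
  apply: mulr_ge0; first by rewrite mulr_ge0 ?sqr_ge0 // ltW.
  by have := b_ge tT; lra.
(* Half of the slack c0 outweighs t beta^2 |g|^2; the other half is kept. *)
have H7 : 0 <= t * beta * (t * c0 / 2 - beta) * `|g t| ^+ 2.
  apply: mulr_ge0; last exact: sqr_ge0.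
  apply: mulr_ge0; first by rewrite mulr_ge0 // ltW.
  have : T * c0 <= t * c0 by rewrite ler_pM2r.
  by move: T_large; lra.
have H8 : 0 <= ((alpha - 3) * t * b t - t ^+ 2 * db t + beta * (2 - alpha)
    - delta * t * b t) * gap t.
  by rewrite mulr_ge0 // subr_ge0 growth.
have H9 : 0 <= k * beta * gap t by rewrite !mulr_ge0 // ltW.
rewrite -subr_ge0.
have := addr_ge0 (addr_ge0 (addr_ge0 (addr_ge0 (addr_ge0 (addr_ge0 (addr_ge0
  (addr_ge0 H1 H2) H3) H4) H5) H6) H7) H8) H9.
move=> /le_trans; apply; rewrite le_eqVlt; apply/orP; left; apply/eqP.
by rewrite /denergy -/h; field; rewrite gt_eqF.
Qed.

Lemma energyE q t : energy q t =
  (t ^+ 2 * b t - beta * (q + 2 - alpha) * t) * gap t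
  + t ^+ 2 * eps t / 2 * `|x t| ^+ 2
  + 2^-1 * `|q *: (x t - z) + t *: w t| ^+ 2
  + q * (alpha - 1 - q) / 2 * `|x t - z| ^+ 2.
Proof.
rewrite (normD_sqr ip_norm (q *: _)) (normZ_sqr ip_norm q) (normZ_sqr ip_norm t).
by rewrite ipZl ipZr /energy /psi; field.
Qed.

Lemma gap_coef_ge q t : T <= t -> q <= alpha - 1 ->
  0 <= t ^+ 2 * b t - beta * (q + 2 - alpha) * t.
Proof.
move=> tT qa; have t0 := t_gt0 tT.
have -> : t ^+ 2 * b t - beta * (q + 2 - alpha) * t =
  t * ((t * b t - beta) + beta * (alpha - 1 - q)) by ring.
apply: mulr_ge0; first exact: ltW.
apply: addr_ge0; first by rewrite subr_ge0 tb_ge.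
by rewrite mulr_ge0 ?subr_ge0 // ltW.
Qed.

Lemma eps_term_ge0 t : T <= t -> 0 <= t ^+ 2 * eps t / 2 * `|x t| ^+ 2.
Proof.
move=> tT; apply: mulr_ge0; last exact: sqr_ge0.
by rewrite divr_ge0 // mulr_ge0 ?sqr_ge0 ?eps_ge0.
Qed.

Lemma energy_ge_dist q t : T <= t -> 0 <= q -> q <= alpha - 1 ->
  q * (alpha - 1 - q) / 2 * `|x t - z| ^+ 2 <= energy q t.
Proof.
move=> tT q0 qa; rewrite energyE lerDr.
apply: addr_ge0; last by rewrite mulr_ge0 ?sqr_ge0 ?invr_ge0.
by apply: addr_ge0; [rewrite mulr_ge0 ?gap_coef_ge ?gap_ge0 | exact: eps_term_ge0].
Qed.

Lemma energy_ge_gap q t : T <= t -> 0 <= q -> q <= alpha - 1 ->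
  (t ^+ 2 * b t - beta * (q + 2 - alpha) * t) * gap t <= energy q t.
Proof.
move=> tT q0 qa; rewrite energyE; have h1 := eps_term_ge0 tT.
have h2 : 0 <= 2^-1 * `|q *: (x t - z) + t *: w t| ^+ 2.
  by rewrite mulr_ge0 ?sqr_ge0 ?invr_ge0.
have h3 : 0 <= q * (alpha - 1 - q) / 2 * `|x t - z| ^+ 2.
  by rewrite mulr_ge0 ?sqr_ge0 // divr_ge0 // mulr_ge0 // subr_ge0.
by apply: ler_wpDr => //; apply: ler_wpDr => //; apply: ler_wpDr.
Qed.

Lemma energy_ge0 q t : T <= t -> 0 <= q -> q <= alpha - 1 -> 0 <= energy q t.
Proof.
move=> tT q0 qa; apply: le_trans (energy_ge_dist tT q0 qa).
by rewrite mulr_ge0 ?sqr_ge0 // divr_ge0 // mulr_ge0 // subr_ge0.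
Qed.

Lemma weight_primitive_cvg : exists l : R, P t @[t --> +oo] --> l.
Proof.
have [|t tT|l Pl] := @nonincreasing_bounded_cvg _ (fun t => - P t) T (- PB).
- apply: (@is_derive_nonincreasing _ _ (fun t => - (t * eps t))) => t tT.
    by have D := DP tT; exact: is_deriveN.
  by rewrite oppr_le0 mulr_ge0 ?eps_ge0 // ltW ?t_gt0.
- by rewrite lerN2 P_le.
exists (- l); apply: cvg_trans (cvgN Pl); apply: near_eq_cvg.
by apply: nearW => t; rewrite /= opprK.
Qed.

(** Subtracting C * P makes F nonincreasing, and P itself has a limit. *)
Lemma almost_nonincreasing_cvg (F dF : R -> R) (C : R) : 0 <= C ->
  (forall t, T <= t -> is_derive t 1 F (dF t)) ->
  (forall t, T <= t -> dF t <= C * (t * eps t)) ->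
  (forall t, T <= t -> 0 <= F t) -> exists l : R, F t @[t --> +oo] --> l.
Proof.
move=> C0 DF dFle F0; have [lP Pl] := weight_primitive_cvg.
have [|t tT|l Fl] := @nonincreasing_bounded_cvg _ (fun t => F t - C * P t) T (- (C * PB)).
- apply: (@is_derive_nonincreasing _ _ (fun t => dF t - (0 * P t + C * (t * eps t)))) => t tT.
    exact: is_derive_sub (DF _ tT) (is_derive_mul (is_derive_const C t) (DP tT)).
  by rewrite mul0r add0r subr_le0 dFle.
- have := F0 t tT; have : C * P t <= C * PB by rewrite ler_wpM2l // P_le.
  by lra.
exists (l + C * lP).
have -> : F = (fun t => (F t - C * P t) + C * P t) by apply/funext => t; rewrite subrK.
by apply: cvgD Fl (cvgM _ Pl); exact: cvg_cst.
Qed.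

Local Notation C1 := ((alpha - 1) / 2 * `|z| ^+ 2).
(* With this weight, the dissipation delta / 2 * (t b gap) of the energy of index
   alpha - 1 exceeds by more than t b gap the term (alpha - 3 - delta) * (t b gap)
   in the derivative of the energy of index 2. *)
Local Notation K := (2 * (alpha - 2) / delta).
Local Notation C2 := (`|z| ^+ 2 + K * C1).
Local Notation combined := (fun t => energy 2 t + K * energy (alpha - 1) t).
Local Notation dcombined := (fun t => denergy 2 t + K * denergy (alpha - 1) t).
Local Notation dissipation t := (t * b t * gap t
  + t * (alpha - 3) * `|dx t| ^+ 2 + beta * c0 / 2 * (t ^+ 2 * `|g t| ^+ 2)).

Let K_ge0 : 0 <= K.
Proof. by rewrite divr_ge0 // ?mulr_ge0 //; [move: alpha_gt3; lra | exact: ltW]. Qed.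

Let C1_ge0 : 0 <= C1.
Proof. by apply: mulr_ge0; [move: alpha_gt3; lra | exact: sqr_ge0]. Qed.

Let C2_ge0 : 0 <= C2.
Proof. by rewrite addr_ge0 ?sqr_ge0 // mulr_ge0. Qed.

(** At the index alpha - 1 the growth condition leaves a negative multiple of the
    gap, half of which is spent on keeping the share delta / 2 of the pairing. *)
Lemma denergy_top_le t : T <= t -> denergy (alpha - 1) t <=
  - (delta / 2 * (t * b t * gap t))
  - delta / 2 * ((t * b t - beta) * ip (g t) (x t - z)) + C1 * (t * eps t).
Proof.
move=> tT; have t0 := t_gt0 tT; have := @denergy_le (alpha - 1) (delta / 2) t tT.
have G0 : 0 <= beta * c0 / 2 * (t ^+ 2 * `|g t| ^+ 2).
  by rewrite !mulr_ge0 ?sqr_ge0 ?invr_ge0 // ltW.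
move: alpha_gt3 delta_gt0 delta_lt => ? ? ? h.
apply: le_trans (h _ _ _ _) _; try lra.
Qed.

Lemma dcombined_le t : T <= t -> dcombined t <= - dissipation t + C2 * (t * eps t).
Proof.
move=> tT; have t0 := t_gt0 tT; have := denergy_top_le tT.
have := @denergy_le 2 0 t tT.
move: alpha_gt3 delta_gt0 delta_lt => ? ? ? h2 h1.
have {h2} := h2 (lexx 0) (ler0n _ _) (lexx 2).
have a1 : 2 <= alpha - 1 by lra.
move=> /(_ a1); rewrite mul0r subr0.
set I := (t * b t - beta) * ip _ _ in h1.
have I0 : 0 <= I.
  apply: mulr_ge0; first by rewrite subr_ge0 tb_ge.
  exact: le_trans (gap_ge0 tT) (gap_le tT).
have G0 : 0 <= t * b t * gap t.
  by rewrite mulr_ge0 ?gap_ge0 // (le_trans (ltW beta_gt0)) // tb_ge.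
have h1' : K * denergy (alpha - 1) t <=
    - ((alpha - 2) * (t * b t * gap t)) + K * (C1 * (t * eps t)).
  have : denergy (alpha - 1) t <= - (delta / 2 * (t * b t * gap t)) + C1 * (t * eps t).
    have : 0 <= delta / 2 * I by rewrite mulr_ge0 // divr_ge0 // ltW.
    by move: h1; move: (delta / 2 * I) => A; lra.
  move=> /(ler_wpM2l K_ge0) /le_trans; apply.
  by rewrite le_eqVlt; apply/orP; left; apply/eqP; field; rewrite gt_eqF.
rewrite divff ?gt_eqF ?ltr0n // mul1r mulrDl -mulrA.
have dG : 0 <= delta * (t * b t * gap t) by rewrite mulr_ge0 // ltW.
move: h1' G0 dG; move: (denergy (alpha - 1) t) (denergy 2 t) => E1 E2.
move=> h1' G0 dG h2; lra.
Qed.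

Lemma denergy_top_le_weight t : T <= t -> denergy (alpha - 1) t <= C1 * (t * eps t).
Proof.
move=> tT; have := denergy_top_le tT.
have I0 : 0 <= delta / 2 * ((t * b t - beta) * ip (g t) (x t - z)).
  apply: mulr_ge0; first by rewrite divr_ge0 // ltW.
  apply: mulr_ge0; first by rewrite subr_ge0 tb_ge.
  exact: le_trans (gap_ge0 tT) (gap_le tT).
have G0 : 0 <= delta / 2 * (t * b t * gap t).
  apply: mulr_ge0; first by rewrite divr_ge0 // ltW.
  by rewrite mulr_ge0 ?gap_ge0 // (le_trans (ltW beta_gt0)) // tb_ge.
move=> h; lra.
Qed.

Lemma dissipation_ge0 t : T <= t -> 0 <= dissipation t.
Proof.
move=> tT; have t0 := t_gt0 tT; apply: addr_ge0; first apply: addr_ge0.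
- by rewrite mulr_ge0 ?gap_ge0 // (le_trans (ltW beta_gt0)) // tb_ge.
- apply: mulr_ge0; last exact: sqr_ge0.
  by apply: mulr_ge0; [exact: ltW | move: alpha_gt3; lra].
- apply: mulr_ge0; last by rewrite mulr_ge0 ?sqr_ge0.
  by rewrite divr_ge0 // mulr_ge0 // ltW.
Qed.

Lemma combined_is_derive t : T <= t -> is_derive t 1 combined (dcombined t).
Proof.
move=> tT; apply: (is_derive_eq (is_derive_add (energy_is_derive 2 tT)
  (is_derive_mul (is_derive_const K t) (energy_is_derive (alpha - 1) tT)))).
by rewrite mul0r add0r.
Qed.

Lemma energy2_le_combined t : T <= t -> energy 2 t <= combined t.
Proof.
move=> tT; rewrite lerDl mulr_ge0 // energy_ge0 //; move: alpha_gt3; lra.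
Qed.

Lemma energy2_ge0 t : T <= t -> 0 <= energy 2 t.
Proof. by move=> tT; apply: energy_ge0 => //; move: alpha_gt3; lra. Qed.

Lemma energy_top_cvg : exists l : R, energy (alpha - 1) t @[t --> +oo] --> l.
Proof.
apply: (almost_nonincreasing_cvg C1_ge0 (energy_is_derive (alpha - 1))).
  exact: denergy_top_le_weight.
by move=> t tT; apply: energy_ge0 => //; move: alpha_gt3; lra.
Qed.

Lemma energy2_cvg : exists l : R, energy 2 t @[t --> +oo] --> l.
Proof.
have [l El] := energy_top_cvg.
have [|t tT|m Fm] := almost_nonincreasing_cvg C2_ge0 combined_is_derive.
- by move=> t tT; have := dcombined_le tT; have := dissipation_ge0 tT; lra.
- exact: le_trans (energy2_ge0 tT) (energy2_le_combined tT).
exists (m - K * l).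
have -> : energy 2 = (fun t => combined t - K * energy (alpha - 1) t).
  by apply/funext => t; rewrite addrK.
by apply: cvgB Fm (cvgM _ El); exact: cvg_cst.
Qed.

Lemma energy2_bounded : exists M : R, forall t, T <= t -> energy 2 t <= M.
Proof.
exists (combined T - C2 * P T + C2 * PB) => t tT.
apply: le_trans (energy2_le_combined tT) _.
have : combined t - C2 * P t <= combined T - C2 * P T.
  apply: (@is_derive_nonincreasing _ (fun t => combined t - C2 * P t)
    (fun t => dcombined t - (0 * P t + C2 * (t * eps t))) T _ _ T t (lexx T) tT) => s sT.
    exact: is_derive_sub (combined_is_derive sT)
      (is_derive_mul (is_derive_const C2 s) (DP sT)).
  by have := dcombined_le sT; have := dissipation_ge0 sT; lra.
have : C2 * P t <= C2 * PB by rewrite ler_wpM2l // P_le.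
by lra.
Qed.

(** The index 2 lies strictly below alpha - 1, so that the energy controls the
    distance to z. *)
Lemma trajectory_bounded : exists M : R, forall t, T <= t -> `|x t| ^+ 2 <= M.
Proof.
have [M Mle] := energy2_bounded.
exists (2 * (M / (alpha - 3)) + 2 * `|z| ^+ 2) => t tT.
have a3 : 0 < alpha - 3 by rewrite subr_gt0.
have : `|x t - z| ^+ 2 <= M / (alpha - 3).
  rewrite ler_pdivlMr // mulrC; apply: le_trans (Mle t tT).
  have -> : alpha - 3 = 2 * (alpha - 1 - 2) / 2 by field.
  by apply: energy_ge_dist => //; move: alpha_gt3; lra.
have : 0 <= `|(x t - z) - z| ^+ 2 by exact: sqr_ge0.
have -> : `|x t| ^+ 2 = `|(x t - z) + z| ^+ 2 by rewrite subrK.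
rewrite (normB_sqr ip_norm (x t - z)) (normD_sqr ip_norm (x t - z)).
by move: (ip _ _) (`|x t - z| ^+ 2) (`|z| ^+ 2) (M / _) => A B C E; lra.
Qed.

Local Notation kappa := (Num.min 1 (alpha - 3)).

Let kappa_gt0 : 0 < kappa.
Proof. by rewrite lt_min ltr01 subr_gt0. Qed.

(** kappa is 1 or alpha - 3 according to the sign of 4 - alpha; in the second
    case beta is bounded by t b. *)
Lemma gap_coef2_ge t : T <= t ->
  kappa * (t ^+ 2 * b t) <= t ^+ 2 * b t - beta * (2 + 2 - alpha) * t.
Proof.
move=> tT; have t0 := t_gt0 tT; have tb := tb_ge tT.
have tb0 : 0 <= t * b t by exact: le_trans (ltW beta_gt0) tb.
have -> : t ^+ 2 * b t - beta * (2 + 2 - alpha) * t =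
  t * (t * b t - beta * (4 - alpha)) by ring.
have -> : kappa * (t ^+ 2 * b t) = t * (kappa * (t * b t)) by ring.
rewrite ler_pM2l //; have [a4|a4] := leP 4 alpha.
  apply: (@le_trans _ _ (t * b t)).
    by rewrite -[leRHS]mul1r ler_wpM2r // ge_min lexx.
  by rewrite lerDl oppr_ge0 pmulr_rle0 // subr_le0.
apply: (@le_trans _ _ ((alpha - 3) * (t * b t))).
  by rewrite ler_wpM2r // ge_min lexx orbT.
have : beta * (4 - alpha) <= t * b t * (4 - alpha).
  by rewrite ler_wpM2r // subr_ge0 ltW.
by lra.
Qed.

(** The energy bounds t^2 b gap, and b is bounded below. *)
Lemma t_gap_cvg0 : t * gap t @[t --> +oo] --> (0 : R).
Proof.
have [M Mle] := energy2_bounded.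
have M0 : 0 <= M by exact: le_trans (energy2_ge0 (lexx T)) (Mle T (lexx T)).
have bound t : T <= t -> t * gap t <= (M / (kappa * c0)) * t^-1.
  move=> tT; have t0 := t_gt0 tT; have gp := gap_ge0 tT.
  rewrite ler_pdivlMr // mulrC ler_pdivlMr ?mulr_gt0 //.
  apply: le_trans (Mle t tT).
  apply: (@le_trans _ _ ((t ^+ 2 * b t - beta * (2 + 2 - alpha) * t) * gap t)); last first.
    by apply: energy_ge_gap => //; move: alpha_gt3; lra.
  have -> : t * (t * gap t) * (kappa * c0) = (kappa * (t ^+ 2 * c0)) * gap t by ring.
  rewrite ler_wpM2r //; apply: le_trans (gap_coef2_ge tT).
  rewrite ler_pM2l // ler_pM2l ?exprn_gt0 //; apply: le_trans (b_ge tT).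
  by rewrite lerDr invr_ge0 ltW.
apply: (@squeeze_cvgr _ _ _ _ (fun=> 0) (fun t => (M / (kappa * c0)) * t^-1)).
- near=> t; have tT : T <= t by near: t; apply: nbhs_pinfty_ge; rewrite num_real.
  by rewrite bound // mulr_ge0 ?gap_ge0 // ltW ?t_gt0.
- exact: cvg_cst.
- rewrite -(mulr0 (M / (kappa * c0))); apply: cvgM; first exact: cvg_cst.
  apply/gtr0_cvgV0; last exact: cvg_id.
  by apply: nbhs_pinfty_gt; rewrite num_real.
Unshelve. all: by end_near. Qed.

(** The energies of index alpha - 1 and 2 differ by alpha - 3 times
    t <x - z, w> + (alpha - 1) / 2 |x - z|^2 - beta t gap, so the sum of the first
    two terms converges, and the energy of index 2 is psi 2 plus twice that sum. *)
Lemma psi2_cvg : exists l : R, psi 2 t @[t --> +oo] --> l.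
Proof.
have [l2 E2] := energy2_cvg; have [l1 E1] := energy_top_cvg.
have a3 : alpha - 3 != 0 by rewrite gt_eqF // subr_gt0.
have -> : psi 2 = (fun t => energy 2 t -
    2 * ((alpha - 3)^-1 * (energy (alpha - 1) t - energy 2 t) + beta * (t * gap t))).
  by apply/funext => t; rewrite /energy /psi; field.
exists (l2 - 2 * ((alpha - 3)^-1 * (l1 - l2) + beta * 0)).
apply: cvgB => //; apply: cvgM; first exact: cvg_cst.
apply: cvgD; apply: cvgM; try exact: cvg_cst; last exact: t_gap_cvg0.
exact: cvgB.
Qed.

Lemma psi2_ge0 t : T <= t -> 0 <= psi 2 t.
Proof.
move=> tT; apply: addr_ge0; last by rewrite mulr_ge0 ?sqr_ge0 // divr_ge0 ?sqr_ge0.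
apply: addr_ge0; last exact: eps_term_ge0.
by rewrite mulr_ge0 ?gap_ge0 // gap_coef_ge //; move: alpha_gt3; lra.
Qed.

(* At least 1 and at least alpha - 2, and at least 1 when multiplied by alpha - 3. *)
Local Notation K' := (alpha - 2 + (alpha - 3)^-1).

(** Each term of psi / t is dissipated by the combined energy, except the one in
    eps, which is a multiple of the integrable weight as x is bounded. *)
Lemma psi2_le_dissipation t M : T <= t -> `|x t| ^+ 2 <= M ->
  psi 2 t * t^-1 <= K' * dissipation t + M / 2 * (t * eps t).
Proof.
move=> tT xM; have t0 := t_gt0 tT; have gp := gap_ge0 tT; have tb := tb_ge tT.
have a3 : 0 < alpha - 3 by rewrite subr_gt0.
have ia3 : 0 < (alpha - 3)^-1 by rewrite invr_gt0.
have tb0 : 0 <= t * b t by exact: le_trans (ltW beta_gt0) tb.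
have K1 : 1 <= K' by move: alpha_gt3; lra.
have H1 : (t * b t - beta * (4 - alpha)) * gap t <= K' * (t * b t * gap t).
  rewrite mulrA ler_wpM2r //; apply: (@le_trans _ _ ((alpha - 2) * (t * b t))).
    have [a4|/ltW a4] := leP 4 alpha.
      have : beta * (alpha - 4) <= t * b t * (alpha - 4) by rewrite ler_wpM2r // subr_ge0.
      by move=> h; lra.
    have : 0 <= beta * (4 - alpha) by rewrite mulr_ge0 ?subr_ge0 // ltW.
    have : 0 <= (alpha - 3) * (t * b t) by rewrite mulr_ge0 // ltW.
    by move=> h1 h2; lra.
  by rewrite ler_wpM2r // lerDl ltW.
have H2 : t * `|dx t| ^+ 2 <= K' * (t * (alpha - 3) * `|dx t| ^+ 2).
  have -> : K' * (t * (alpha - 3) * `|dx t| ^+ 2) =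
    (K' * (alpha - 3)) * (t * `|dx t| ^+ 2) by ring.
  rewrite -[leLHS]mul1r; apply: ler_wpM2r; first by rewrite mulr_ge0 ?sqr_ge0 // ltW.
  rewrite mulrDl mulVf ?gt_eqF // lerDr mulr_ge0 //; last exact: ltW.
  by move: alpha_gt3; lra.
have H3 : t * beta ^+ 2 * `|g t| ^+ 2 <= K' * (beta * c0 / 2 * (t ^+ 2 * `|g t| ^+ 2)).
  apply: (@le_trans _ _ (beta * c0 / 2 * (t ^+ 2 * `|g t| ^+ 2))); last first.
    rewrite -[leLHS]mul1r ler_wpM2r // mulr_ge0 //; last by rewrite mulr_ge0 ?sqr_ge0.
    by rewrite divr_ge0 // mulr_ge0 // ltW.
  have -> : beta * c0 / 2 * (t ^+ 2 * `|g t| ^+ 2) =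
     (t * beta) * (t * c0 / 2) * `|g t| ^+ 2 by field.
  rewrite ler_wpM2r ?sqr_ge0 // expr2 mulrA ler_wpM2l //; first by rewrite mulr_ge0 // ltW.
  have : T * c0 <= t * c0 by rewrite ler_pM2r.
  by move: T_large; lra.
have H4 : `|w t| ^+ 2 <= 2 * `|dx t| ^+ 2 + 2 * (beta ^+ 2 * `|g t| ^+ 2).
  have : 0 <= `|dx t - beta *: g t| ^+ 2 by exact: sqr_ge0.
  rewrite (normB_sqr ip_norm) (normD_sqr ip_norm) (normZ_sqr ip_norm).
  by move: (ip _ _) (`|dx t| ^+ 2) (beta ^+ 2 * _) => A B C; lra.
have H5 : t * `|w t| ^+ 2 <= 2 * (t * `|dx t| ^+ 2) + 2 * (t * beta ^+ 2 * `|g t| ^+ 2).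
  apply: le_trans (ler_wpM2l (ltW t0) H4) _.
  by rewrite le_eqVlt; apply/orP; left; apply/eqP; ring.
have H6 : t * eps t / 2 * `|x t| ^+ 2 <= M / 2 * (t * eps t).
  have -> : M / 2 * (t * eps t) = t * eps t / 2 * M by field.
  by rewrite ler_wpM2l // divr_ge0 // mulr_ge0 ?eps_ge0 // ltW.
have -> : psi 2 t * t^-1 = (t * b t - beta * (4 - alpha)) * gap t +
    t * eps t / 2 * `|x t| ^+ 2 + t * `|w t| ^+ 2 / 2.
  by rewrite /psi; field; rewrite gt_eqF.
rewrite [K' * _]mulrDr [K' * (_ + _)]mulrDr; move: H1 H2 H3 H5 H6.
move: ((t * b t - beta * (4 - alpha)) * gap t) (K' * (t * b t * gap t)) => A A'.
move: (K' * (t * (alpha - 3) * `|dx t| ^+ 2)) (t * `|dx t| ^+ 2) => B' B.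
move: (K' * (beta * c0 / 2 * (t ^+ 2 * `|g t| ^+ 2))) (t * beta ^+ 2 * `|g t| ^+ 2) => C' C.
move: (t * `|w t| ^+ 2) (t * eps t / 2 * `|x t| ^+ 2) (M / 2 * (t * eps t)) => E I J.
by lra.
Qed.

(** As psi(t)/t is dominated by integrable quantities, a limit L > 0 would make
    L / 2 * ln t bounded. *)
Lemma psi2_cvg0 : psi 2 t @[t --> +oo] --> (0 : R).
Proof.
have [L psiL] := psi2_cvg; have [M xM] := trajectory_bounded.
have M0 : 0 <= M by apply: le_trans (xM T (lexx T)); exact: sqr_ge0.
have K0 : 0 < K'.
  by rewrite addr_gt0 ?invr_gt0 ?subr_gt0 //; move: alpha_gt3; lra.
have L0 : 0 <= L.
  apply: (cvgr_to_ge psiL); near=> t; apply: psi2_ge0.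
  by near: t; apply: nbhs_pinfty_ge; rewrite num_real.
have [<-//|Lneq0] := eqVneq L 0.
have Lpos : 0 < L by rewrite lt_neqAle eq_sym Lneq0.
have [T2 TT2 psi_ge] : exists2 S, T <= S & forall t, S <= t -> L / 2 <= psi 2 t.
  have : \forall t \near +oo, L / 2 <= psi 2 t by apply: (cvgr_ge L psiL); lra.
  move=> [S [_ SP]]; exists (Num.max T (S + 1)); first by rewrite le_max lexx.
  by move=> t; rewrite ge_max => /andP[_ St]; apply: SP; lra.
pose C4 := K' * C2 + M / 2.
have C40 : 0 <= C4 by rewrite addr_ge0 ?mulr_ge0 // ltW.
pose Y t := K' * combined t - C4 * P t + L / 2 * ln t.
pose dY t := (0 * combined t + K' * dcombined t) - (0 * P t + C4 * (t * eps t)) +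
  (0 * ln t + L / 2 * t^-1).
have Ydec t : T2 <= t -> Y t <= Y T2.
  move=> T2t; apply: (@is_derive_nonincreasing _ Y dY T2 _ _ T2 t (lexx T2) T2t) => s T2s.
    have sT := le_trans TT2 T2s.
    exact: is_derive_add (is_derive_sub
      (is_derive_mul (is_derive_const K' s) (combined_is_derive sT))
      (is_derive_mul (is_derive_const C4 s) (DP sT)))
      (is_derive_mul (is_derive_const (L / 2) s) (is_derive1_ln (t_gt0 sT))).
  have sT := le_trans TT2 T2s; have s0 := t_gt0 sT.
  have := ler_wpM2l (ltW K0) (dcombined_le sT).
  have := psi2_le_dissipation sT (xM s sT).
  have : L / 2 * s^-1 <= psi 2 s * s^-1 by rewrite ler_pM2r ?invr_gt0 // psi_ge.
  have -> : K' * (- dissipation s + C2 * (s * eps s)) =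
    - (K' * dissipation s) + K' * C2 * (s * eps s) by ring.
  rewrite /dY !mul0r !add0r /C4 (mulrDl (K' * C2)).
  move: (psi 2 s / s) (L / 2 / s) (K' * dissipation s) (M / 2 * (s * eps s))
    (K' * C2 * (s * eps s)) (K' * (denergy 2 s + K * denergy (alpha - 1) s)).
  by move=> A B C E I J; lra.
pose B := (Y T2 + C4 * PB) / (L / 2).
have ln_le t : T2 <= t -> ln t <= B.
  move=> T2t; have tT := le_trans TT2 T2t.
  rewrite ler_pdivlMr ?divr_gt0 // mulrC.
  have := Ydec t T2t; rewrite {1}/Y.
  have : 0 <= K' * combined t.
    by rewrite mulr_ge0 ?(ltW K0) // (le_trans (energy2_ge0 tT)) // energy2_le_combined.
  have : C4 * P t <= C4 * PB by rewrite ler_wpM2l // P_le.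
  by move: (K' * _) (C4 * P t) (C4 * PB) (L / 2 * _) (Y T2) => A1 B1 E1 I1 J1; lra.
have T20 : 0 < T2 := t_gt0 TT2.
have := ln_le (T2 + expR (B + 1)) _; rewrite lerDl expR_ge0 => /(_ isT).
have : ln (expR (B + 1)) <= ln (T2 + expR (B + 1)).
  by rewrite ler_ln ?posrE ?addr_gt0 ?expR_gt0 // lerDr ltW.
by rewrite expRK => h1 h2; exfalso; lra.
Unshelve. all: by end_near. Qed.

Lemma psi_cvg0 q : psi q t @[t --> +oo] --> (0 : R).
Proof.
have -> : psi q = (fun t => psi 2 t - beta * (q - 2) * (t * gap t)).
  by apply/funext => t; rewrite /psi; ring.
have -> : 0 = 0 - beta * (q - 2) * 0 :> R by rewrite mulr0 subr0.
apply: cvgB; first exact: psi2_cvg0.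
by apply: cvgM; [exact: cvg_cst | exact: t_gap_cvg0].
Qed.

Lemma gap_rate : t ^+ 2 * b t * gap t @[t --> +oo] --> (0 : R).
Proof.
apply: (@squeeze_cvgr _ _ _ _ (fun=> 0) (fun t => kappa^-1 * psi 2 t)).
- near=> t; have tT : T <= t by near: t; apply: nbhs_pinfty_ge; rewrite num_real.
  have gp := gap_ge0 tT.
  rewrite mulr_ge0 //=; last first.
    by rewrite mulr_ge0 ?sqr_ge0 // (le_trans _ (b_ge tT)) // addr_ge0 ?invr_ge0 // ltW.
  rewrite ler_pdivlMl // mulrA.
  apply: (@le_trans _ _ ((t ^+ 2 * b t - beta * (2 + 2 - alpha) * t) * gap t)).
    by rewrite ler_wpM2r // gap_coef2_ge.
  rewrite /psi; apply: ler_wpDr; first by rewrite mulr_ge0 ?sqr_ge0 // divr_ge0 ?sqr_ge0.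
  by apply: ler_wpDr => //; exact: eps_term_ge0.
- exact: cvg_cst.
- rewrite -(mulr0 kappa^-1); apply: cvgM; first exact: cvg_cst.
  exact: psi2_cvg0.
Unshelve. all: by end_near. Qed.

Lemma velocity_rate : (t * `|w t|) ^+ 2 @[t --> +oo] --> (0 : R).
Proof.
apply: (@squeeze_cvgr _ _ _ _ (fun=> 0) (fun t => 2 * psi 2 t)).
- near=> t; have tT : T <= t by near: t; apply: nbhs_pinfty_ge; rewrite num_real.
  rewrite sqr_ge0 /= exprMn.
  have : 0 <= (t ^+ 2 * b t - beta * (2 + 2 - alpha) * t) * gap t.
    by rewrite mulr_ge0 ?gap_ge0 // gap_coef_ge //; move: alpha_gt3; lra.
  have -> : t ^+ 2 * `|w t| ^+ 2 = 2 * (t ^+ 2 / 2 * `|w t| ^+ 2) by field.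
  move=> h; rewrite ler_pM2l // /psi.
  by apply: ler_wpDl => //; apply: addr_ge0 => //; exact: eps_term_ge0.
- exact: cvg_cst.
- rewrite -(mulr0 2); apply: cvgM; first exact: cvg_cst.
  exact: psi2_cvg0.
Unshelve. all: by end_near. Qed.

(** The share delta / 2 of the pairing kept in denergy_top_le is dissipated by the
    energy of index alpha - 1. *)
Lemma pairing_primitive_bounded (Q : R -> R) :
  (forall t, T <= t -> is_derive t 1 Q ((t * b t - beta) * ip (g t) (x t - z))) ->
  exists B, forall t, T <= t -> Q t <= B.
Proof.
move=> DQ; pose Y t := energy (alpha - 1) t + delta / 2 * Q t - C1 * P t.
exists ((Y T + C1 * PB) / (delta / 2)) => t tT.
have d2 : 0 < delta / 2 by rewrite divr_gt0.
rewrite ler_pdivlMr // mulrC.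
have : Y t <= Y T.
  apply: (@is_derive_nonincreasing _ Y (fun s => denergy (alpha - 1) s +
    (0 * Q s + delta / 2 * ((s * b s - beta) * ip (g s) (x s - z))) -
    (0 * P s + C1 * (s * eps s))) T _ _ T t (lexx T) tT) => s sT.
    exact: is_derive_sub (is_derive_add (energy_is_derive _ sT)
      (is_derive_mul (is_derive_const _ s) (DQ s sT)))
      (is_derive_mul (is_derive_const _ s) (DP sT)).
  have := denergy_top_le sT; rewrite !mul0r !add0r.
  have : 0 <= delta / 2 * (s * b s * gap s).
    by rewrite mulr_ge0 ?(ltW d2) // mulr_ge0 ?gap_ge0 // (le_trans (ltW beta_gt0)) // tb_ge.
  move: (delta / 2 * (_ * gap s)) (delta / 2 * (_ * ip _ _)) (C1 * _).
  by move=> A B C h1 h2; lra.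
have : C1 * P t <= C1 * PB by rewrite ler_wpM2l // P_le.
have : 0 <= energy (alpha - 1) t by apply: energy_ge0 => //; move: alpha_gt3; lra.
rewrite {1}/Y; move: (C1 * P t) (C1 * PB) (delta / 2 * Q t) (Y T) => A B C E; lra.
Qed.

Theorem lyapunov_rates :
  [/\ forall q, psi q t @[t --> +oo] --> (0 : R),
      t ^+ 2 * b t * gap t @[t --> +oo] --> (0 : R),
      (t * `|w t|) ^+ 2 @[t --> +oo] --> (0 : R) &
      forall Q : R -> R,
        (forall t, T <= t ->
           is_derive t 1 Q ((t * b t - beta) * ip (g t) (x t - z))) ->
        exists B, forall t, T <= t -> Q t <= B].
Proof.
by split; [exact: psi_cvg0 | exact: gap_rate | exact: velocity_rate |
  exact: pairing_primitive_bounded].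
Qed.

End Lyapunov.

(** * Primitives and improper integrals *)

Section Primitive.
Context {R : realType}.
Local Notation mu := (@lebesgue_measure R).
Context (a : R) (f : R -> R).
Local Notation D := `[a, +oo[%classic.
Hypothesis f_continuous : {within D, continuous f}.

Definition primitive (t : R) : R := (\int[mu]_(s in `[a, t]) f s)%R.

Lemma continuous_itv_integrable u : mu.-integrable `[a, u] (EFin \o f).
Proof.
apply: continuous_compact_integrable; first exact: segment_compact.
by apply: continuous_subspaceW f_continuous; apply: subset_itvl.
Qed.

Lemma primitive_is_derive t : a < t -> is_derive t 1 primitive (f t).
Proof.
move=> at_; have tt1 : t < t + 1 by rewrite ltrDl.
have [fc _] := (continuous_within_itvcyP _ _).1 f_continuous.
have [|dF FE] := @continuous_FTC1_closed _ f a t (t + 1) tt1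
  (continuous_itv_integrable _) at_.
  by apply: fc; rewrite in_itv /= at_.
by split; [exact: dF | rewrite -derive1E].
Qed.

Hypothesis f_ge0 : forall t, a <= t -> 0 <= f t.

Lemma continuous_itvcy_measurable : measurable_fun D f.
Proof. exact: subspace_continuous_measurable_fun. Qed.

Lemma primitive_le_integral t : a <= t ->
  (\int[mu]_(s in D) (f s)%:E < +oo)%E ->
  primitive t <= fine (\int[mu]_(s in D) (f s)%:E)%E.
Proof.
move=> at_ foo.
have f0 s : D s -> (0 <= (f s)%:E)%E.
  by rewrite /= in_itv /= andbT => /f_ge0; rewrite lee_fin.
have Dfin : (\int[mu]_(s in D) (f s)%:E)%E \is a fin_num.
  by rewrite ge0_fin_numE //; exact: integral_ge0.
have sub : `[a, t]%classic `<=` D by apply: subset_itvl.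
have le : (\int[mu]_(s in `[a, t]) (f s)%:E <= \int[mu]_(s in D) (f s)%:E)%E.
  apply: ge0_subset_integral => //.
  apply/measurable_EFinP; exact: continuous_itvcy_measurable.
rewrite /primitive /Rintegral fine_le // ge0_fin_numE.
  exact: le_lt_trans le foo.
by apply: integral_ge0 => s /sub; exact: f0.
Qed.

Lemma bounded_primitive_integrable (T B : R) : a <= T ->
  (forall t, T <= t -> primitive t <= B) -> mu.-integrable D (EFin \o f).
Proof.
move=> aT FB.
(* The primitive is known to be differentiable only to the right of a. *)
pose S := Num.max T (a + 1).
have aS : a < S by rewrite lt_max ltrDl ltr01 orbT.
have TS : T <= S by rewrite le_max lexx.
have [|t St|l Fl] := @nonincreasing_bounded_cvg _ (fun t => - primitive t) S (- B).
- apply: (@is_derive_nonincreasing _ _ (fun t => - f t)) => t St.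
    have D := primitive_is_derive (lt_le_trans aS St); exact: is_deriveN.
  by rewrite oppr_le0 f_ge0 // ltW // (lt_le_trans aS).
- by rewrite lerN2 FB // (le_trans TS).
have Pl : primitive t @[t --> +oo] --> - l.
  have -> : primitive = (fun t => - - primitive t) by apply/funext => t; rewrite opprK.
  exact: cvgN.
apply/integrableP; split.
  by apply/measurable_EFinP; exact: continuous_itvcy_measurable.
have -> : (\int[mu]_(s in D) `|(EFin \o f) s| = \int[mu]_(s in D) (f s)%:E)%E.
  apply: eq_integral => s; rewrite inE /= in_itv /= andbT => as_.
  by rewrite ger0_norm ?f_ge0.
rewrite (ge0_continuous_FTC2y f_ge0 f_continuous Pl).
- by rewrite -EFinB ltry.
- by move=> t at_; have [] := primitive_is_derive at_.
- have -> : primitive a = 0 by rewrite /primitive set_itv1 Rintegral_set1.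
  apply: cvg_at_right_filter.
  apply: (@parameterized_integral_cvg_left _ a (a + 1)); first by rewrite ltrDl.
  exact: continuous_itv_integrable.
- move=> t; rewrite in_itv /= andbT => at_.
  by rewrite derive1E; have [_] := primitive_is_derive at_.
Qed.

End Primitive.

(** * Asymptotic comparison *)

Section Asymptotics.
Context {R : realType}.
Implicit Types (f r u : R -> R).

Lemma littleo_of_rate f r u : (\forall t \near +oo, 0 < r t) ->
  (\forall t \near +oo, `|r t * f t| <= u t) -> u t @[t --> +oo] --> (0 : R) ->
  f =o_at_pinfty (fun t => (r t)^-1).
Proof.
move=> r0 ru u0; apply/eqoP => e e0.
have ue : \forall t \near +oo, u t <= e by apply: (cvgr_le _ u0).
suff : \forall t \near +oo, `|f t| <= e * `|(r t)^-1| by [].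
near=> t; have rt : 0 < r t by near: t.
rewrite normfV (gtr0_norm rt) ler_pdivlMr //.
rewrite -{1}(gtr0_norm rt) -normrM mulrC.
by apply: (@le_trans _ _ (u t)); near: t.
Unshelve. all: by end_near. Qed.

Lemma littleo_of_sqr_rate f r u : (\forall t \near +oo, 0 < r t) ->
  (\forall t \near +oo, (r t * f t) ^+ 2 <= u t) -> u t @[t --> +oo] --> (0 : R) ->
  f =o_at_pinfty (fun t => (r t)^-1).
Proof.
move=> r0 ru u0; apply: (littleo_of_rate (u := fun t => Num.sqrt (u t))) => //.
  near=> t; rewrite -sqrtr_sqr; apply: ler_wsqrtr; by near: t.
have -> : 0 = Num.sqrt 0 :> R by rewrite sqrtr0.
by apply: (cvg_comp _ _ u0); exact: sqrt_continuous.
Unshelve. all: by end_near. Qed.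

(** Were l negative, f would decrease to the right of t at rate at least - l / 2. *)
Lemma nondecreasing_is_derive_ge0 f (t l : R) :
  (forall s, t <= s -> f t <= f s) -> is_derive t 1 f l -> 0 <= l.
Proof.
move=> fndecr /is_deriveP fl; rewrite leNgt; apply/negP => l0.
have l20 : 0 < - l / 2 by rewrite divr_gt0 // oppr_gt0.
have : \forall s \near t^'+, t < s /\ `|f s - f t - (s - t) *: l| <= - l / 2 * `|s - t|.
  near=> s; split; first by near: s; exact: nbhs_right_gt.
  by near: s; exact: cvg_within (fl _ l20).
move=> /(@filter_ex _ _ (at_right_proper_filter t)) [s [ts]].
have st0 : 0 < s - t by rewrite subr_gt0.
rewrite (gtr0_norm st0) ler_norml => /andP[_ h].
have h1 : f s - f t <= (s - t) * (l / 2).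
  have : f s - f t <= - l / 2 * (s - t) + (s - t) * l by rewrite -lerBlDr.
  by move=> /le_trans; apply; rewrite le_eqVlt; apply/orP; left; apply/eqP; field.
have : (s - t) * (l / 2) < 0 by rewrite pmulr_rlt0 // pmulr_llt0 // invr_gt0.
have := fndecr s (ltW ts); rewrite -subr_ge0 => h2.
by move=> /(le_lt_trans (le_trans h2 h1)); rewrite ltxx.
Unshelve. all: by end_near. Qed.

End Asymptotics.

(** * Convergence of the trajectory *)

Theorem theorem5 (R : realType) (H : completeNormedModType R)
  (ip : {dot H for idfun}) (ip_norm : forall u : H, ip u u = `|u| ^+ 2)
  (Phi : H -> \bar R)
  (Phi_proper : proper_ereal Phi) (Phi_convex : convex_ereal Phi)
  (Phi_lsc : lower_semicontinuous Phi) (Phi_argmin : argmin Phi !=set0)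
  (alpha beta t0 : R)
  (alpha_gt0 : 0 < alpha) (beta_gt0 : 0 < beta) (t0_gt0 : 0 < t0)
  (lambda b eps : R -> R)
  (lambda_gt0 : forall t, t0 <= t -> 0 < lambda t)
  (lambda_ndecr : forall s t, t0 <= s -> s <= t -> lambda s <= lambda t)
  (lambda_derivable :
    forall t, t0 <= t -> derivable_within `[t0, +oo[%classic lambda t)
  (b_ge0 : forall t, t0 <= t -> 0 <= b t)
  (b_ndecr : forall s t, t0 <= s -> s <= t -> b s <= b t)
  (b_derivable : forall t, t0 <= t -> derivable_within `[t0, +oo[%classic b t)
  (eps_ge0 : forall t, t0 <= t -> 0 <= eps t)
  (eps_C1 : cont_derivable_within `[t0, +oo[%classic eps)
  (eps_nincr : forall s t, t0 <= s -> s <= t -> eps t <= eps s)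
  (eps_cvg0 : eps t @[t --> +oo] --> (0 : R))
  (alpha_gt3 : 3 < alpha)
  (a delta : R) (a_ge1 : 1 <= a)
  (delta_gt0 : 0 < delta) (delta_lt : delta < alpha - 3)
  (eps_deriv : forall t, t0 <= t ->
    2 * derive_within `[t0, +oo[%classic eps t <= - a * beta * eps t ^+ 2)
  (eps_int :
    (\int[lebesgue_measure]_(t in `[t0, +oo[%classic) (t * eps t)%:E < +oo)%E)
  (b_t0 : beta / t0 <= b t0) (b_t0_gt : a^-1 < b t0)
  (b_growth : forall t, t0 <= t ->
    delta * t * b t <=
      (alpha - 3) * t * b t - t ^+ 2 * derive_within `[t0, +oo[%classic b t
      + beta * (2 - alpha))
  (x : R -> H) (x0 v0 : H)
  (x_sol : strong_solution ip alpha beta t0 Phi lambda b eps x0 v0 x) :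
  let xstar := metric_proj (argmin Phi) 0 in
  let dx := derive_within `[t0, +oo[%classic x in
  let g := fun t => grad_moreau ip Phi (lambda t) (x t) in
  let p := fun t => prox Phi (lambda t) (x t) in
  let gap := fun t => moreau Phi (lambda t) (x t) - min_value Phi in
  let psi := fun (q t : R) =>
    (t ^+ 2 * b t - beta * (q + 2 - alpha) * t) * gap t
    + t ^+ 2 * eps t / 2 * `|x t| ^+ 2
    + t ^+ 2 / 2 * `|dx t + beta *: g t| ^+ 2 in
  [/\ lebesgue_measure.-integrable `[t0, +oo[%classic
        (fun t => (t * ip ((b t - beta / t) *: g t) (x t - xstar))%:E),
      forall q, 2 <= q -> q <= alpha - 1 -> psi q t @[t --> +oo] --> (0 : R),
      gap =o_at_pinfty (fun t => (t ^+ 2 * b t)^-1) /\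
      (fun t => `|dx t + beta *: g t|) =o_at_pinfty (fun t => t^-1) &
      [/\ (fun t => fine (Phi (p t)) - min_value Phi) =o_at_pinfty
            (fun t => (t ^+ 2 * b t)^-1),
          (fun t => `|p t - x t|) =o_at_pinfty
            (fun t => Num.sqrt (lambda t) / (t * Num.sqrt (b t))) &
          (fun t => `|g t|) =o_at_pinfty (fun t => (t * Num.sqrt (b t * lambda t))^-1)]].
Proof.
move=> xstar dx g p gap psi.
have [[x_der dx_cont] dx_ac x_eq _] := x_sol.
have tD t : `[t0, +oo[%classic t -> t0 <= t by rewrite /= in_itv /= andbT.
have Dt t : t0 <= t -> `[t0, +oo[%classic t by rewrite /= in_itv /= andbT.
have {}x_der t : t0 <= t -> derivable_within `[t0, +oo[%classic x t.
  by move=> /Dt; exact: x_der.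
have eps_der t : t0 <= t -> derivable_within `[t0, +oo[%classic eps t.
  by move=> /Dt; have [+ _] := eps_C1; exact.
have xstarP : argmin Phi xstar.
  exact: (metric_proj_argmin ip_norm).
have gE t : t0 <= t -> g t = yosida Phi (lambda t) (x t).
  by move=> tt; rewrite /g (grad_moreauE ip_norm) // lambda_gt0.
have a_gt0 : 0 < a by rewrite (lt_le_trans ltr01).
pose c0 := b t0 - a^-1.
have c0_gt0 : 0 < c0 by rewrite subr_gt0.
(* From T on, beta <= t c0 / 2. *)
pose T := t0 + 1 + 2 * beta / c0.
have bc0 : 0 < 2 * beta / c0 by rewrite divr_gt0 // mulr_gt0.
have t0T : t0 < T by rewrite /T; lra.
have T_gt0 : 0 < T by exact: lt_trans t0T.
have T_large : 2 * beta <= T * c0.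
  by rewrite -ler_pdivrMr // /T; lra.
have tT t : T <= t -> t0 < t by exact: lt_le_trans.
have tT' t : T <= t -> t0 <= t by move=> /tT /ltW.
have tb_ge t : t0 <= t -> beta <= t * b t.
  move=> tt; have tpos : 0 < t by exact: lt_le_trans tt.
  rewrite mulrC -ler_pdivrMr //; apply: (@le_trans _ _ (b t0)); last exact: b_ndecr.
  apply: le_trans b_t0; rewrite ler_pM2l // lef_pV2 ?posrE //.
have b_ge t : t0 <= t -> a^-1 + c0 <= b t.
  by move=> tt; rewrite /c0 addrC subrK b_ndecr.
pose h t := t * ip ((b t - beta / t) *: g t) (x t - xstar).
have hE t : t0 <= t -> h t = (t * b t - beta) * ip (g t) (x t - xstar).
  move=> tt; have tpos : 0 < t by exact: lt_le_trans tt.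
  by rewrite /h ipZl; field; rewrite gt_eqF.
have gap_ge0 t : t0 <= t -> 0 <= gap t.
  by move=> tt; apply: (moreau_gap_ge0 ip_norm) => //; exact: lambda_gt0.
have gap_le t : t0 <= t -> gap t <= ip (g t) (x t - xstar).
  move=> tt; rewrite gE //.
  by apply: (moreau_gap_le ip_norm) => //; exact: lambda_gt0.
have h_ge0 t : t0 <= t -> 0 <= h t.
  move=> tt; rewrite hE // mulr_ge0 ?subr_ge0 ?tb_ge //.
  exact: le_trans (gap_ge0 t tt) (gap_le t tt).
have teps_cont : {within `[t0, +oo[%classic, continuous (fun t => t * eps t)}.
  apply/subspace_continuousP => t /tD tt; apply: cvgM.
    exact: cvg_within_filter cvg_id.
  exact: derivable_within_cvg (eps_der t tt).
have h_cont : {within `[t0, +oo[%classic, continuous h}.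
  apply/subspace_continuousP => t /tD tt.
  have tpos : 0 < t by exact: lt_le_trans tt.
  have idc : s @[s --> within `[t0, +oo[%classic (nbhs t)] --> t.
    exact: cvg_within_filter cvg_id.
  have bc := derivable_within_cvg (b_derivable t tt).
  have xc := derivable_within_cvg (x_der t tt).
  have gc := grad_trajectory_cvg ip_norm Phi_proper Phi_convex Phi_lsc Phi_argmin
    lambda_gt0 lambda_ndecr lambda_derivable x_der tt.
  apply: cvgM => //; apply: (cvg_ip ip_norm); last by apply: cvgB => //; exact: cvg_cst.
  apply: cvgZ => //; apply: cvgB => //; apply: cvgM; first exact: cvg_cst.
  by apply: cvgV => //; rewrite gt_eqF.
have teps_ge0 t : t0 <= t -> 0 <= t * eps t.
  by move=> tt; rewrite mulr_ge0 ?eps_ge0 // (le_trans (ltW t0_gt0)).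
have [psi0 gap0 w0 Qbnd] := @lyapunov_rates R H ip ip_norm alpha beta a delta c0 T
  (fine (\int[lebesgue_measure]_(t in `[t0, +oo[%classic) (t * eps t)%:E)%E)
  xstar x dx g gap b eps (primitive t0 (fun t => t * eps t))
  (derive_within `[t0, +oo[%classic b) (derive_within `[t0, +oo[%classic eps)
  (derive_within `[t0, +oo[%classic lambda)
  alpha_gt3 beta_gt0 a_gt0 delta_gt0 delta_lt c0_gt0 T_gt0 T_large
  (fun t Tt => derivable_within_is_derive (tT t Tt) (x_der t (tT' t Tt)))
  (fun t Tt => velocity_is_derive ip_norm Phi_proper Phi_convex Phi_lsc Phi_argmin
     lambda_gt0 lambda_ndecr lambda_derivable x_der t0_gt0 beta_gt0 b_derivable eps_der
     dx_cont dx_ac x_eq (tT t Tt))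
  (fun t Tt => gap_is_derive ip_norm Phi_proper Phi_convex Phi_lsc Phi_argmin
     lambda_gt0 lambda_derivable x_der (tT t Tt))
  (fun t Tt => derivable_within_is_derive (tT t Tt) (b_derivable t (tT' t Tt)))
  (fun t Tt => derivable_within_is_derive (tT t Tt) (eps_der t (tT' t Tt)))
  (fun t Tt => primitive_is_derive teps_cont (tT t Tt))
  (fun t Tt => primitive_le_integral teps_cont teps_ge0 (tT' t Tt) eps_int)
  (fun t Tt => nondecreasing_is_derive_ge0 (fun s ts => lambda_ndecr t s (tT' t Tt) ts)
     (derivable_within_is_derive (tT t Tt) (lambda_derivable t (tT' t Tt))))
  (fun t Tt => gap_ge0 t (tT' t Tt)) (fun t Tt => gap_le t (tT' t Tt))
  (fun t Tt => eps_ge0 t (tT' t Tt)) (fun t Tt => eps_deriv t (tT' t Tt))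
  (fun t Tt => tb_ge t (tT' t Tt)) (fun t Tt => b_ge t (tT' t Tt))
  (fun t Tt => b_growth t (tT' t Tt)).
have near_T : \forall t \near +oo, T <= t by apply: nbhs_pinfty_ge; rewrite num_real.
have b_pos t : T <= t -> 0 < b t.
  by move=> /tT' /b_ge; apply: lt_le_trans; rewrite addr_gt0 ?invr_gt0.
have t_pos t : T <= t -> 0 < t by exact: lt_le_trans.
have t2b_pos t : T <= t -> 0 < t ^+ 2 * b t.
  by move=> Tt; rewrite mulr_gt0 ?exprn_gt0 ?b_pos ?t_pos.
have near_rate : \forall t \near +oo, 0 < t ^+ 2 * b t by apply: filterS near_T.
have l_pos t : T <= t -> 0 < lambda t by move=> /tT'; exact: lambda_gt0.
have gap_split t : T <= t ->
    gap t = (fine (Phi (p t)) - min_value Phi) + lambda t / 2 * `|g t| ^+ 2.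
  by move=> Tt; rewrite gE ?tT' //; apply: (moreau_gapE ip_norm) => //; exact: l_pos.
have value_ge0 t : T <= t -> 0 <= fine (Phi (p t)) - min_value Phi.
  by move=> Tt; apply: (prox_gap_ge0 ip_norm) => //; exact: l_pos.
have grad_rate t : T <= t ->
    t ^+ 2 * (b t * lambda t) * `|g t| ^+ 2 <= 2 * (t ^+ 2 * b t * gap t).
  move=> Tt; have := mulr_ge0 (ltW (t2b_pos t Tt)) (value_ge0 t Tt).
  rewrite gap_split // => h1; rewrite -subr_ge0; apply: le_trans (mulr_ge0 (ler0n R 2) h1) _.
  by rewrite le_eqVlt; apply/orP; left; apply/eqP; field.
have gap20 : 2 * (t ^+ 2 * b t * gap t) @[t --> +oo] --> (0 : R).
  by rewrite -(mulr0 2); apply: cvgM => //; exact: cvg_cst.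
split.
- have [t Tt|B QB] := Qbnd (primitive t0 h).
    rewrite -(hE t (tT' t Tt)); exact: (primitive_is_derive h_cont (tT t Tt)).
  exact: (bounded_primitive_integrable h_cont h_ge0 (ltW t0T) QB).
- by move=> q _ _; exact: psi0.
- split.
    apply: (littleo_of_rate near_rate _ gap0).
    near=> t; have Tt : T <= t by near: t.
    by rewrite ger0_norm // mulr_ge0 ?gap_ge0 ?tT' // ltW // t2b_pos.
  apply: (littleo_of_sqr_rate (r := id) _ _ w0).
    by apply: filterS near_T => t; exact: t_pos.
  by near=> t.
split.
- apply: (littleo_of_rate near_rate _ gap0).
  near=> t; have Tt : T <= t by near: t.
  have r0 := ltW (t2b_pos t Tt).
  rewrite (ger0_norm (mulr_ge0 r0 (value_ge0 t Tt))) ler_wpM2l // gap_split // lerDl.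
  by rewrite mulr_ge0 ?sqr_ge0 // divr_ge0 // ltW // l_pos.
- have -> : (fun t => Num.sqrt (lambda t) / (t * Num.sqrt (b t))) =
      (fun t => ((t * Num.sqrt (b t)) / Num.sqrt (lambda t))^-1).
    by apply/funext => t; rewrite invf_div.
  apply: (littleo_of_sqr_rate _ _ gap20).
    apply: filterS near_T => t Tt.
    by rewrite divr_gt0 ?mulr_gt0 ?sqrtr_gt0 ?b_pos ?l_pos ?t_pos.
  apply: filterS near_T => t Tt; apply: le_trans (grad_rate t Tt).
  have l0 := l_pos t Tt; have b0 := b_pos t Tt.
  rewrite distrC /p sub_proxE ?gt_eqF // -gE ?tT' // normrZ (gtr0_norm l0).
  rewrite !exprMn exprVn (sqr_sqrtr (ltW b0)) (sqr_sqrtr (ltW l0)).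
  by rewrite le_eqVlt; apply/orP; left; apply/eqP; field; rewrite gt_eqF.
- apply: (littleo_of_sqr_rate _ _ gap20).
    apply: filterS near_T => t Tt.
    by rewrite mulr_gt0 ?sqrtr_gt0 ?mulr_gt0 ?b_pos ?l_pos ?t_pos.
  apply: filterS near_T => t Tt; apply: le_trans (grad_rate t Tt).
  have l0 := l_pos t Tt; have b0 := b_pos t Tt.
  by rewrite !exprMn sqr_sqrtr // mulr_ge0 // ltW.
Unshelve. all: by end_near. Qed.
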